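(* Let $M$ be a finite dimensional left $\Lambda$-module with top $T = M/JM = \bigoplus_{i=1}^n S_i^{t_i}$. Then $M$ has no proper top-stable degenerations if and only if the following two conditions are satisfied: (a) $M \cong \bigoplus_{i=1}^n \bigoplus_{j=1}^{t_i} \Lambda e_i / C_{ij}$, where, for each $i \le n$, the $C_{ij}$ are left ideals contained in $\Lambda e_i$ which are linearly ordered under inclusion. (b) $f(C_{ij}) \subseteq C_{kl}$ for all $f \in \mathrm{Hom}_\Lambda(\Lambda e_i, J e_k)$ and all pairs $(i,j)$ and $(k,l)$ (not necessarily distinct).
   Context: $K$ is an algebraically closed field and $\Lambda$ is a basic finite dimensional $K$-algebra with Jacobson radical $J$. $e_1,\dots,e_n$ is a full sequence of (orthogonal) primitive idempotents of $\Lambda$, and $S_i = \Lambda e_i/Je_i$ are the simple left modules. The top of a module $M$ is $M/JM$. A degeneration of a module $M$ with dimension vector $\mathbf d$ is any module $M'$ represented by a point in the closure of the $\mathrm{GL}(\mathbf d)$-orbit of $M$ in the classical affine variety parametrizing the $\Lambda$-modules with dimension vector $\mathbf d$. It is proper if $M' \not\cong M$, and top-stable if $M'/JM' \cong M/JM$. *)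

(* Defs.v *)
From HB Require Import structures.
From mathcomp Require Import all_boot all_order all_algebra all_field.
From mathcomp Require Import boolp.
From mathcomp Require Export mpoly.

Set Implicit Arguments.
Unset Strict Implicit.
Unset Printing Implicit Defensive.

Import GRing.Theory VectorInternalTheory.
Local Open Scope ring_scope.

Section Modules.
Variables (K : fieldType) (A : falgType K).

(* A finite dimensional left A-module: a K-space together with an algebra map
   to its endomorphisms. *)
Record fdmod := FdMod {
  carrier :> vectType K;
  act : {linear A -> 'End(carrier)};
  act1 : act 1 = \1%VF;
  actM : forall a b, act (a * b) = (act a \o act b)%VF }.

Definition is_hom (M N : fdmod) (f : 'Hom(M, N)) :=
  forall a x, f (act M a x) = act N a (f x).

Definition iso (M N : fdmod) :=
  exists f : 'Hom(M, N), is_hom f /\ bijective f.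

(* The span of all products a x with a in I and x in U; see actv_subP. *)
Definition actv (M : fdmod) (I : {vspace A}) (U : {vspace M}) : {vspace M} :=
  (\sum_(a <- vbasis I) (act M a @: U))%VS.

Lemma actv_subP (M : fdmod) (I : {vspace A}) (U W : {vspace M}) :
  reflect (forall a x, a \in I -> x \in U -> act M a x \in W)
          (actv I U <= W)%VS.
Proof.
apply: (iffP idP) => [/subvP sW a x aI xU | h].
  apply: sW; rewrite (coord_vbasis aI) linear_sum sum_lfunE.
  apply: memv_suml => i _; rewrite linearZ scale_lfunE memvZ //.
  rewrite /actv (big_nth 0) big_mkord size_tuple (bigD1 i) //=.
  by apply: (subvP (addvSl _ _) _ (memv_img _ xU)).
rewrite /actv big_seq; 
  apply: (big_ind (fun V => V <= W)%VS) => [|U1 U2 s1 s2|a /vbasis_mem aI].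
- by rewrite sub0v.
- by rewrite subv_add s1.
by apply/subvP=> _ /memv_imgP[x xU ->]; apply: h.
Qed.

Lemma memv_act (M : fdmod) (I : {vspace A}) (U : {vspace M}) a x :
  a \in I -> x \in U -> act M a x \in actv I U.
Proof. exact: (actv_subP I U _ (subvv _)). Qed.

Record submod (M : fdmod) := Submod {
  sub_space :> {vspace M};
  sub_stable : (actv fullv sub_space <= sub_space)%VS }.

Lemma submodP (M : fdmod) (U : submod M) a x :
  x \in (U : {vspace M}) -> act M a x \in (U : {vspace M}).
Proof. by move=> xU; exact: (actv_subP _ _ _ (sub_stable U)) (memvf a) xU. Qed.

Section SubModule.
Variables (M : fdmod) (U : submod M).

Definition sub_act (a : A) : 'End(subvs_of U) :=
  (linfun (vsproj U) \o act M a \o linfun vsval)%VF.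

Lemma sub_actE a u : vsval (sub_act a u) = act M a (vsval u).
Proof. by rewrite !comp_lfunE !lfunE /= vsprojK // submodP // subvsP. Qed.

Fact sub_act_linear : linear sub_act.
Proof.
move=> k a b; apply/lfunP=> u; apply: val_inj.
rewrite -[LHS]/(vsval _) -[RHS]/(vsval _) (sub_actE (k *: a + b) u).
rewrite (add_lfunE (k *: sub_act a)) scale_lfunE (linearP vsval) /= (sub_actE a) (sub_actE b).
by rewrite linearP add_lfunE scale_lfunE.
Qed.
HB.instance Definition _ :=
  GRing.isLinear.Build K A 'End(subvs_of U) _ sub_act sub_act_linear.

Fact sub_act1 : sub_act 1 = \1%VF.
Proof. by apply/lfunP=> u; apply: val_inj; rewrite -[LHS]/(vsval _) sub_actE act1 !id_lfunE. Qed.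

Fact sub_actM a b : sub_act (a * b) = (sub_act a \o sub_act b)%VF.
Proof.
apply/lfunP=> u; apply: val_inj.
by rewrite comp_lfunE -[LHS]/(vsval _) -[RHS]/(vsval _) !sub_actE actM comp_lfunE.
Qed.

Definition submodule : fdmod := FdMod sub_act1 sub_actM.
End SubModule.

(* M / U is realized on the complement U^C chosen by the library, the canonical
   projection quot_proj being the projection onto U^C along U. *)
Section QuotientModule.
Variables (M : fdmod) (U : submod M).

Definition quot_proj : 'Hom(M, subvs_of U^C) :=
  (linfun (vsproj (U^C)%VS) \o daddv_pi (U^C)%VS U)%VF.

Definition quot_act (a : A) : 'End(subvs_of U^C) :=
  (quot_proj \o act M a \o linfun vsval)%VF.

Let capCU : (U^C :&: U = 0)%VS.
Proof. by rewrite capvC capv_compl. Qed.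

Lemma vsval_quot_proj x : vsval (quot_proj x) = daddv_pi (U^C)%VS U x.
Proof. by rewrite comp_lfunE lfunE /= vsprojK // memv_pi. Qed.

Lemma quot_proj_val u : quot_proj (vsval u) = u.
Proof. by apply/val_inj/(etrans (vsval_quot_proj _)); rewrite daddv_pi_id ?subvsP. Qed.

Lemma quot_proj_eq0 x : (quot_proj x == 0) = (x \in (U : {vspace M})).
Proof.
have xE : daddv_pi (U^C)%VS U x + daddv_pi U (U^C)%VS x = x.
  by apply: daddv_pi_add => //; rewrite addvC addv_complf memvf.
apply/eqP/idP => [/(congr1 vsval)|xU].
  by rewrite vsval_quot_proj linear0 => p0; rewrite -xE p0 add0r memv_pi.
apply/val_inj/(etrans (vsval_quot_proj _)); rewrite [RHS]linear0.
by move: xE; rewrite (daddv_pi_id (capv_compl _) xU) => /(canRL (addrK _));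
  rewrite subrr.
Qed.

Lemma quot_actE a u : quot_act a u = quot_proj (act M a (vsval u)).
Proof. by rewrite /quot_act comp_lfunE comp_lfunE (lfunE vsval). Qed.

Lemma quot_proj_act a x : quot_proj (act M a x) = quot_act a (quot_proj x).
Proof.
apply/eqP; rewrite quot_actE -subr_eq0 -(linearB quot_proj) quot_proj_eq0.
rewrite -(linearB (act M a)) submodP // -quot_proj_eq0 (linearB quot_proj) /=.
by rewrite quot_proj_val subrr.
Qed.

Fact quot_act_linear : linear quot_act.
Proof.
move=> k a b; apply/lfunP=> u.
by rewrite add_lfunE scale_lfunE !quot_actE linearP add_lfunE scale_lfunE linearP.
Qed.
HB.instance Definition _ :=
  GRing.isLinear.Build K A 'End(subvs_of U^C) _ quot_act quot_act_linear.

Fact quot_act1 : quot_act 1 = \1%VF.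
Proof. by apply/lfunP=> u; rewrite quot_actE act1 !id_lfunE quot_proj_val. Qed.

Fact quot_actM a b : quot_act (a * b) = (quot_act a \o quot_act b)%VF.
Proof.
apply/lfunP=> u; rewrite quot_actE actM (comp_lfunE (act M a)) quot_proj_act.
by rewrite -quot_actE [RHS]comp_lfunE.
Qed.

Definition quotient : fdmod := FdMod quot_act1 quot_actM.
End QuotientModule.

(* W meet U as a submodule of the module U, so that subquotient U W is U / W
   when W is contained in U. *)
Section Subquotient.
Variables (M : fdmod) (U W : submod M).

Fact restrict_stable :
  (actv fullv (linfun vsval @^-1: W : {vspace submodule U})
    <= linfun vsval @^-1: W)%VS.
Proof.
apply/actv_subP => a x _; rewrite -!memv_preim !(lfunE vsval) /=.
by move/(submodP a); rewrite -sub_actE.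
Qed.

Definition subquotient : fdmod := quotient (Submod restrict_stable).
End Subquotient.

Section DirectSum.
Variables (n : nat) (M : 'I_n -> fdmod).

Definition dsum_carrier := {dffun forall i, M i}.
HB.instance Definition _ := Choice.on dsum_carrier.
Implicit Types x y z : dsum_carrier.

Definition dsum_zero : dsum_carrier := [ffun i => 0 : M i].
Definition dsum_add x y : dsum_carrier := [ffun i => x i + y i].
Definition dsum_opp x : dsum_carrier := [ffun i => - x i].
Definition dsum_scale (k : K) x : dsum_carrier := [ffun i => k *: x i].

Fact dsum_addA : associative dsum_add.
Proof. by move=> x y z; apply/ffunP=> i; rewrite !ffunE addrA. Qed.
Fact dsum_addC : commutative dsum_add.
Proof. by move=> x y; apply/ffunP=> i; rewrite !ffunE addrC. Qed.
Fact dsum_add0 : left_id dsum_zero dsum_add.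
Proof. by move=> x; apply/ffunP=> i; rewrite !ffunE add0r. Qed.
Fact dsum_addN : left_inverse dsum_zero dsum_opp dsum_add.
Proof. by move=> x; apply/ffunP=> i; rewrite !ffunE addNr. Qed.
HB.instance Definition _ :=
  GRing.isZmodule.Build dsum_carrier dsum_addA dsum_addC dsum_add0 dsum_addN.

Fact dsum_scaleA k l x : dsum_scale k (dsum_scale l x) = dsum_scale (k * l) x.
Proof. by apply/ffunP=> i; rewrite !ffunE scalerA. Qed.
Fact dsum_scale1 : left_id 1 dsum_scale.
Proof. by move=> x; apply/ffunP=> i; rewrite !ffunE scale1r. Qed.
Fact dsum_scaleDr : right_distributive dsum_scale +%R.
Proof. by move=> k x y; apply/ffunP=> i; rewrite !ffunE scalerDr. Qed.
Fact dsum_scaleDl x : {morph dsum_scale^~ x : k l / k + l}.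
Proof. by move=> k l; apply/ffunP=> i; rewrite !ffunE scalerDl. Qed.
HB.instance Definition _ := GRing.Zmodule_isLmodule.Build K dsum_carrier
  dsum_scaleA dsum_scale1 dsum_scaleDr dsum_scaleDl.

Fact dsum_vect_iso : Vector.axiom (\sum_i dim (M i)) dsum_carrier.
Proof.
exists (fun x => \mxrow_i v2r (x i)).
  by move=> k x y; apply/rowP=> j; rewrite !mxE !ffunE linearP !mxE.
exists (fun r => [ffun i => r2v (submxrow r i) : M i]) => [x|r].
  by apply/ffunP=> i; rewrite ffunE mxrowK v2rK.
by apply/mxrowP=> i; rewrite mxrowK ffunE r2vK.
Qed.
HB.instance Definition _ := Lmodule_hasFinDim.Build K dsum_carrier dsum_vect_iso.

Definition dsum_map a x : dsum_carrier := [ffun i => act (M i) a (x i)].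

Fact dsum_map_linear a : linear (dsum_map a).
Proof. by move=> k x y; apply/ffunP=> i; rewrite !ffunE linearP. Qed.
HB.instance Definition _ a := GRing.isLinear.Build K dsum_carrier dsum_carrier _
  (dsum_map a) (dsum_map_linear a).

Definition dsum_act a : 'End(dsum_carrier) := linfun (dsum_map a).

Fact dsum_act_linear : linear dsum_act.
Proof.
move=> k a b; apply/lfunP=> x; apply/ffunP=> i.
by rewrite add_lfunE scale_lfunE !lfunE /= !ffunE linearP add_lfunE scale_lfunE.
Qed.
HB.instance Definition _ :=
  GRing.isLinear.Build K A 'End(dsum_carrier) _ dsum_act dsum_act_linear.

Fact dsum_act1 : dsum_act 1 = \1%VF.
Proof.
by apply/lfunP=> x; apply/ffunP=> i; rewrite lfunE /= ffunE act1 !id_lfunE.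
Qed.

Fact dsum_actM a b : dsum_act (a * b) = (dsum_act a \o dsum_act b)%VF.
Proof.
apply/lfunP=> x; apply/ffunP=> i.
by rewrite comp_lfunE !lfunE /= !ffunE actM comp_lfunE.
Qed.

Definition dsum : fdmod := FdMod dsum_act1 dsum_actM.
End DirectSum.

Fact regular_actM (a b : A) : amull (a * b) = (amull a \o amull b)%VF.
Proof. by apply/lfunP=> x; rewrite comp_lfunE !lfunE /= mulrA. Qed.

Definition regular : fdmod := FdMod (@amull1 K A) regular_actM.

Definition left_ideal := submod regular.

Definition maximal_left_ideal (I : left_ideal) :=
  (I : {vspace A}) <> fullv /\
  forall I' : left_ideal, ((I : {vspace A}) <= (I' : {vspace A}))%VS ->
    (I' : {vspace A}) = (I : {vspace A}) \/ (I' : {vspace A}) = fullv.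

Fact jacobson_ex : exists J : {vspace A}, forall x, x \in J <->
  forall I : left_ideal, maximal_left_ideal I -> x \in (I : {vspace A}).
Proof.
pose P x := forall I : left_ideal, maximal_left_ideal I -> x \in (I : {vspace A}).
pose Q k := `[< exists U : {vspace A}, (forall x, x \in U -> P x) /\ \dim U = k >].
have exQ : exists k, Q k.
  exists 0%N; apply/asboolP; exists 0%VS; split; last by rewrite dimv0.
  by move=> x /[!memv0] /eqP -> I _; rewrite mem0v.
have bQ k : Q k -> (k <= \dim {:A})%N.
  by case/asboolP => U [_ <-]; rewrite dimvS ?subvf.
case: (ex_maxnP exQ bQ) => k /asboolP[U [UP dU]] maxk.
exists U => x; split=> [|Px]; first exact: UP.
have : Q (\dim (U + <[x]>)).
  apply/asboolP; exists (U + <[x]>)%VS; split=> // y.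
  case/memv_addP=> u uU [_ /vlineP[c ->] ->] I mI.
  by rewrite memvD ?memvZ ?Px ?UP.
move/maxk; rewrite -dU => le_d.
have /eqP -> : U == (U + <[x]>)%VS by rewrite eqEdim addvSl.
by rewrite (subvP (addvSr _ _)) ?memv_line.
Qed.

(* The Jacobson radical: the intersection of all maximal left ideals. *)
Definition jacobson : {vspace A} := projT1 (cid jacobson_ex).

Lemma jacobsonP x : x \in jacobson <->
  forall I : left_ideal, maximal_left_ideal I -> x \in (I : {vspace A}).
Proof. exact: (projT2 (cid jacobson_ex)). Qed.

Lemma jacobsonMl a x : x \in jacobson -> a * x \in jacobson.
Proof.
move/jacobsonP=> xJ; apply/jacobsonP => I mI.
by have := @submodP regular I a x (xJ I mI); rewrite lfunE.
Qed.

Fact rad_stable (M : fdmod) :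
  (actv fullv (actv jacobson (fullv : {vspace M})) <= actv jacobson fullv)%VS.
Proof.
apply/actv_subP => a x _; rewrite memv_preim; apply/subvP: x.
apply/actv_subP => b y bJ _.
by rewrite -memv_preim -comp_lfunE -actM memv_act ?memvf ?jacobsonMl.
Qed.

Definition rad (M : fdmod) : submod M := Submod (rad_stable M).

Definition top (M : fdmod) : fdmod := quotient (rad M).

Fact prodv_stable (I V : {vspace A}) :
  (forall a x, x \in I -> a * x \in I) ->
  (actv fullv ((I * V)%VS : {vspace regular}) <= I * V)%VS.
Proof.
move=> mulI; apply/actv_subP => a x _; rewrite memv_preim; apply/subvP.
apply/prodvP=> b v bI vV; rewrite -memv_preim lfunE /= mulrA.
by rewrite memv_mul ?mulI.
Qed.

(* prodv takes spans of products; with a line on the right these are already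
   all the products a * e, with a in A, respectively in J. *)
Definition Ae (e : A) : left_ideal :=
  @Submod regular ({:A} * <[e]>)%VS (prodv_stable _ (fun _ _ _ => memvf _)).
Definition Je (e : A) : left_ideal :=
  @Submod regular (jacobson * <[e]>)%VS (prodv_stable _ jacobsonMl).

Definition simple_mod (e : A) : fdmod := subquotient (Ae e) (Je e).

Definition idempotent_elt (a : A) := a * a = a.

Definition primitive_idempotent (a : A) :=
  [/\ idempotent_elt a, a <> 0 &
    forall b c, idempotent_elt b -> idempotent_elt c -> b * c = 0 -> c * b = 0 ->
      a = b + c -> b = 0 \/ c = 0].

Definition full_primitive_idempotents (n : nat) (e : 'I_n -> A) :=
  [/\ forall i, primitive_idempotent (e i),
      forall i j, i != j -> e i * e j = 0 &
      \sum_i e i = 1].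

(* The indecomposable projectives A e_i are pairwise non-isomorphic. By
   Krull-Schmidt this does not depend on the full sequence e. *)
Definition basic (n : nat) (e : 'I_n -> A) :=
  forall i j, iso (submodule (Ae (e i))) (submodule (Ae (e j))) -> i = j.

End Modules.

Definition affine_coord (K : fieldType) (V : vectType K) (x : V) :
  'I_(\dim {:V}) -> K := fun i => coord (vbasis {:V}) i x.

(* A basis identifies V with affine space; the closure does not depend on it. *)
Definition zariski_closure (K : fieldType) (V : vectType K) (S : V -> Prop)
    (x : V) :=
  forall p : {mpoly K[\dim {:V}]},
    (forall y, S y -> p.@[affine_coord y] = 0) -> p.@[affine_coord x] = 0.

Section Degenerations.
Variables (K : fieldType) (A : falgType K) (n : nat) (e : 'I_n -> A).

Definition dimension_vector (M : fdmod A) (i : 'I_n) : nat :=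
  \dim (limg (act M (e i))).

(* Module structures of dimension vector d on K^d = K^(d_1) (+) ... (+) K^(d_n)
   for which e_i is the projection onto the i-th block. The (j, i) block of
   such a structure gives the maps by which e_j A e_i acts. *)
Section Variety.
Variable d : 'I_n -> nat.
Local Notation N := (\sum_i d i)%N.

Definition mod_variety (rho : 'Hom(A, 'M[K]_N)) :=
  [/\ rho 1 = 1%:M,
      forall a b, rho (a * b) = rho a *m rho b &
      forall i, rho (e i) = \mxdiag_j (((j == i)%:R)%:M : 'M[K]_(d j))].

(* The orbit of rho under GL(d) = GL_(d_1) x ... x GL_(d_n). *)
Definition GL_orbit (rho sigma : 'Hom(A, 'M[K]_N)) :=
  exists g : forall i, 'M[K]_(d i), (forall i, g i \in unitmx) /\
    forall a, sigma a = \mxdiag_i g i *m rho a *m invmx (\mxdiag_i g i).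

Definition represents (rho : 'Hom(A, 'M[K]_N)) (M : fdmod A) :=
  exists f : 'Hom('cV[K]_N, M), bijective f /\
    forall a v, f (rho a *m v) = act M a (f v).
End Variety.

Definition degeneration (M M' : fdmod A) :=
  exists rho rho' : 'Hom(A, 'M[K]_(\sum_i dimension_vector M i)),
    [/\ mod_variety rho, represents rho M,
        mod_variety rho', represents rho' M' &
        zariski_closure (GL_orbit rho) rho'].

Definition proper_top_stable_degeneration (M M' : fdmod A) :=
  [/\ degeneration M M', ~ iso M' M & iso (top M') (top M)].

End Degenerations.

(* Main.v *)
Require Import Defs.
From HB Require Import structures.
From mathcomp Require Import all_boot all_order all_algebra all_field.
From mathcomp Require Import boolp zify.

Set Implicit Arguments.
Unset Strict Implicit.
Unset Printing Implicit Defensive.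

Import GRing.Theory.
Local Open Scope ring_scope.

Local Notation rad := Defs.rad.
Local Notation top := Defs.top.

(** Write M = P / C with P projective and C inside the radical of P; the
    projective module is itself taken as a quotient of the free module on the
    slots (i, j) with j < t_i. Top-stable degenerations are produced by limits of
    submodules: for an endomorphism v of P, the submodules (v + s) C, which give
    quotients isomorphic to M for almost all s, tend for s -> 0 to v C + D, where
    D is the largest v-stable submodule of C (dim_limit). The quotient of P by
    this limit is a degeneration of M (limit_degeneration): the quotients
    P / (v + s) C are realized on one vector space by matrices depending
    rationally on s, and a polynomial vanishing on an orbit vanishes along such a
    curve (zariski_curve).

    Suppose that M has no proper top-stable degenerations. Then every such limit
    again has quotient M. Fix a filtration of P which is raised by the
    homomorphisms A e_i -> J e_k and by those sending a generator to a later one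
    with the same idempotent. Among all C with P / C isomorphic to M, one for
    which the sum of the dimensions of the intersections with the filtration is
    maximal is stable under all these homomorphisms, since otherwise the limit
    would have a larger sum (potential_ex). Limits for the coordinate projections
    do not decrease the sum and make C homogeneous (stable_admissible).
    Homogeneity yields the decomposition of M, and stability yields the linear
    order and the condition on homomorphisms (rigid_presentation). This is an
    elementary form of the fact that a closed orbit of a connected group in a
    projective variety has a point fixed by a Borel subgroup.

    Conversely, let M be the direct sum of the A e_i / C_ij and let M' be a
    top-stable degeneration. The dimension of the space of all x in e_i M with
    C_ij x = 0 can only grow under degeneration (degeneration_killed). In M this
    space contains e_i rad M, by the condition on homomorphisms, and the
    generators belonging to all C_il that contain C_ij. As the C_ij are linearly
    ordered, generators of M' satisfying the same relations can be picked one
    after the other, independently modulo the radical (pick_generators). They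
    generate M' by Nakayama's lemma, and comparing dimensions gives an
    isomorphism of M' with M (rigid_iso). *)

(** * Modules, submodules and quotients *)

(** A predicate closed under linear combinations defines a subspace. *)
Lemma vspace_of_pred (K : fieldType) (V : vectType K) (Q : V -> Prop) :
  Q 0 -> (forall k x y, Q x -> Q y -> Q (k *: x + y)) ->
  exists U : {vspace V}, forall x, x \in U <-> Q x.
Proof.
move=> Q0 Qlin; pose R k := `[< exists U : {vspace V},
  (forall x, x \in U -> Q x) /\ \dim U = k >].
have exR : exists k, R k.
  exists 0%N; apply/asboolP; exists 0%VS; split; last by rewrite dimv0.
  by move=> x /[!memv0] /eqP ->.
have bR k : R k -> (k <= \dim {:V})%N.
  by case/asboolP => U [_ <-]; rewrite dimvS ?subvf.
case: (ex_maxnP exR bR) => k /asboolP[U [UQ dU]] maxk.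
exists U => x; split=> [|Qx]; first exact: UQ.
have : R (\dim (<[x]> + U)).
  apply/asboolP; exists (<[x]> + U)%VS; split=> // y.
  by case/memv_addP=> _ /vlineP[c ->] [u uU ->]; apply: Qlin => //; apply: UQ.
move/maxk; rewrite -dU => le_d.
have /eqP -> : U == (<[x]> + U)%VS by rewrite eqEdim addvSr.
by rewrite (subvP (addvSl _ _)) ?memv_line.
Qed.

Section ModuleBasics.
Variables (K : fieldType) (A : falgType K).
Implicit Types M N P : fdmod A.

Lemma actDl M a b x : act M (a + b) x = act M a x + act M b x.
Proof. by rewrite linearD add_lfunE. Qed.

Lemma actBl M a b x : act M (a - b) x = act M a x - act M b x.
Proof. by rewrite linearB add_lfunE opp_lfunE. Qed.

Lemma actZl M k a x : act M (k *: a) x = k *: act M a x.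
Proof. by rewrite linearZ scale_lfunE. Qed.

Lemma act0l M x : act M 0 x = 0.
Proof. by rewrite linear0 zero_lfunE. Qed.

Lemma act_suml M (I : Type) (r : seq I) (Q : pred I) (F : I -> A) x :
  act M (\sum_(i <- r | Q i) F i) x = \sum_(i <- r | Q i) act M (F i) x.
Proof. by rewrite linear_sum sum_lfunE. Qed.

Lemma actMx M a b x : act M (a * b) x = act M a (act M b x).
Proof. by rewrite actM comp_lfunE. Qed.

Lemma act1x M x : act M 1 x = x.
Proof. by rewrite act1 id_lfunE. Qed.

(** The submodule carried by a subspace closed under the action. *)
Definition submod_of M (U : {vspace M})
    (h : forall a x, x \in U -> act M a x \in U) : submod M :=
  Submod (introT (actv_subP fullv U U) (fun a x _ => h a x)).

Lemma bij_lfun (V W : vectType K) (f : 'Hom(V, W)) :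
  (forall x, f x = 0 -> x = 0) -> (forall y, exists x, y = f x) -> bijective f.
Proof.
move=> finj fsurj; exists f^-1%VF.
  apply: lker0_lfunK; rewrite -subv0; apply/subvP=> x.
  by rewrite memv_ker memv0 => /eqP /finj ->.
move=> y; apply: limg_lfunVK; have [x ->] := fsurj y.
by rewrite memv_img ?memvf.
Qed.

Lemma bij_lfun_dim (V W : vectType K) (f : 'Hom(V, W)) :
  (forall x, f x = 0 -> x = 0) -> \dim {:V} = \dim {:W} -> bijective f.
Proof.
move=> finj dVW; apply: bij_lfun => // y.
have lk : (lker f = 0)%VS.
  apply/eqP; rewrite -subv0; apply/subvP=> x.
  by rewrite memv_ker memv0 => /eqP /finj ->.
have e : limg f = fullv.
  by apply/eqP; rewrite eqEdim subvf /= limg_dim_eq ?lk ?capv0 // dVW.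
have /memv_imgP[x _ ->] : y \in limg f by rewrite e memvf.
by exists x.
Qed.

Lemma bij_lfun_surj_dim (V W : vectType K) (f : 'Hom(V, W)) :
  (forall y, exists x, y = f x) -> \dim {:V} = \dim {:W} -> bijective f.
Proof.
move=> fsurj dVW; apply: bij_lfun => // x fx0.
have e : limg f = fullv.
  apply/vspaceP=> y; rewrite memvf; have [z ->] := fsurj y.
  by rewrite memv_img ?memvf.
have := limg_ker_dim f fullv; rewrite e dVW capfv -[RHS]add0n => /addIn /eqP.
rewrite dimv_eq0 => /eqP lk.
by apply/eqP; rewrite -memv0 -lk memv_ker fx0.
Qed.

Lemma bij_dim (V W : vectType K) (f : 'Hom(V, W)) :
  bijective f -> \dim {:V} = \dim {:W}.
Proof.
case=> g fK gK; have e : limg f = fullv.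
  by apply/vspaceP=> y; rewrite memvf -(gK y) memv_img ?memvf.
rewrite -e limg_dim_eq // capfv; apply/eqP; rewrite -subv0; apply/subvP=> x.
by rewrite memv_ker memv0 -(inj_eq (can_inj fK)) linear0.
Qed.

Lemma lfun_inv (V W : vectType K) (f : 'Hom(V, W)) : bijective f ->
  cancel f f^-1%VF /\ cancel f^-1%VF f.
Proof.
case=> g fK gK; split; last first.
  by move=> y; apply: limg_lfunVK; rewrite -(gK y) memv_img ?memvf.
apply: lker0_lfunK; rewrite -subv0; apply/subvP=> x.
by rewrite memv_ker memv0 -(inj_eq (can_inj fK)) linear0.
Qed.

Lemma iso_sym M N : iso M N -> iso N M.
Proof.
case=> f [fh fb]; have [fK fVK] := lfun_inv fb.
exists f^-1%VF; split; last by exists f.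
by move=> a y; apply: (can_inj fK); rewrite fh !fVK.
Qed.

Lemma iso_trans M N P : iso M N -> iso N P -> iso M P.
Proof.
case=> f [fh fb] [g [gh gb]]; exists (g \o f)%VF; split.
  by move=> a x; rewrite !comp_lfunE fh gh.
by apply: (eq_bij (bij_comp gb fb)) => x; rewrite comp_lfunE.
Qed.

Lemma iso_dim M N : iso M N -> \dim {:M} = \dim {:N}.
Proof. by case=> f [_ /bij_dim]. Qed.

(** The projection of a module onto a quotient, up to elements of the
    submodule. *)
Lemma quot_proj_valB M (U : submod M) x :
  vsval (quot_proj U x) - x \in (U : {vspace M}).
Proof.
by rewrite -quot_proj_eq0 linearB /= quot_proj_val subrr.
Qed.

Lemma quot_surj M (U : submod M) (y : quotient U) : exists x, y = quot_proj U x.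
Proof. by exists (vsval y); rewrite quot_proj_val. Qed.

Lemma quot_hom M (U : submod M) a x :
  quot_proj U (act M a x) = act (quotient U) a (quot_proj U x).
Proof. exact: quot_proj_act. Qed.

(** First isomorphism theorem. *)
Lemma first_iso M N (f : 'Hom(M, N)) (U : submod M) : is_hom f ->
  (forall y, exists x, y = f x) ->
  (forall x, (f x == 0) = (x \in (U : {vspace M}))) -> iso (quotient U) N.
Proof.
move=> fh fsurj fker.
have fval x : f (vsval (quot_proj U x)) = f x.
  by apply/eqP; rewrite -subr_eq0 -linearB fker quot_proj_valB.
pose g : 'Hom(quotient U, N) := (f \o linfun vsval)%VF.
have gE u : g u = f (vsval u) by rewrite comp_lfunE lfunE.
exists g; split.
  move=> a u; have [x ->] := quot_surj u.
  by rewrite -quot_hom !gE !fval fh.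
apply: bij_lfun => [u|y].
  by rewrite gE => /eqP; rewrite fker -quot_proj_eq0 quot_proj_val => /eqP.
by have [x ->] := fsurj y; exists (quot_proj U x); rewrite gE fval.
Qed.

End ModuleBasics.

(** * The Jacobson radical *)

Section Radical.
Variables (K : fieldType) (A : falgType K).
Implicit Types M N : fdmod A.
Local Notation J := (jacobson A).

Definition eval_fun M (x : M) (a : A) : M := act M a x.

Fact eval_fun_linear M (x : M) : linear (eval_fun x).
Proof. by move=> k a b; rewrite /eval_fun actDl actZl. Qed.
HB.instance Definition _ M (x : M) :=
  GRing.isLinear.Build K A M _ (eval_fun x) (eval_fun_linear x).

(** The A-linear map from A to M sending 1 to x. *)
Definition eval_at M (x : M) : 'Hom(A, M) := linfun (eval_fun x).

Lemma eval_atE M (x : M) a : eval_at x a = act M a x.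
Proof. by rewrite lfunE. Qed.

Lemma regularE (a x : A) : act (regular A) a x = a * x.
Proof. by rewrite lfunE. Qed.

Lemma left_idealMl (I : left_ideal A) (a b : A) :
  b \in (I : {vspace A}) -> a * b \in (I : {vspace A}).
Proof. by move=> bI; have := @submodP _ _ (regular A) I a b bI; rewrite regularE. Qed.

Lemma colon_stable M (V : submod M) (x : M) (a b : A) :
  b \in (eval_at x @^-1: V)%VS ->
  act (regular A) a b \in (eval_at x @^-1: V)%VS.
Proof.
by rewrite regularE -!memv_preim !eval_atE actMx; apply: submodP.
Qed.

(** The left ideal of all a such that a x lies in V. *)
Definition colon M (V : submod M) (x : M) : left_ideal A :=
  @submod_of K A (regular A) (eval_at x @^-1: V)%VS (@colon_stable M V x).

Lemma mem_colon M (V : submod M) x a :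
  (a \in (colon V x : {vspace A})) = (act M a x \in (V : {vspace M})).
Proof. by rewrite -memv_preim eval_atE. Qed.

(** A proper submodule that is maximal among the proper submodules. *)
Definition maximal_submod M (V : submod M) :=
  (V : {vspace M}) <> fullv /\
  forall W : submod M, ((V : {vspace M}) <= (W : {vspace M}))%VS ->
    (W : {vspace M}) = (V : {vspace M}) \/ (W : {vspace M}) = fullv.

Lemma maximal_submod_add M (V : submod M) x y : maximal_submod V ->
  x \notin (V : {vspace M}) -> exists b, y - act M b x \in (V : {vspace M}).
Proof.
case=> _ Vmax xV.
have Wst a z : z \in (V + limg (eval_at x))%VS ->
    act M a z \in (V + limg (eval_at x))%VS.
  case/memv_addP=> v vV [_ /memv_imgP[b bI ->] ->]; rewrite linearD /=.
  apply: memv_add; first exact: submodP.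
  by rewrite eval_atE -actMx -eval_atE memv_img ?memvf.
have [e|e] := Vmax (submod_of Wst) (addvSl _ _).
  case/negP: xV; have <- := e; apply: (subvP (addvSr _ _)).
  by have := memv_img (eval_at x) (memvf 1); rewrite eval_atE act1x.
have := memvf y; have <- := e.
case/memv_addP=> v vI [_ /memv_imgP[b _ ->]] ->.
by exists b; rewrite eval_atE addrK.
Qed.

Lemma colon_maximal M (V : submod M) x : maximal_submod V ->
  x \notin (V : {vspace M}) -> maximal_left_ideal (colon V x).
Proof.
move=> VV xV; split=> [e|I VI].
  by move: xV; rewrite -[x]act1x -mem_colon e memvf.
have [<-|nI] := eqVneq (colon V x : {vspace A}) I; [by left|right].
have [b bI bV] : exists2 b, b \in (I : {vspace A}) & act M b x \notin (V : {vspace M}).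
  have /subvPn[b bI] : ~~ ((I : {vspace A}) <= colon V x)%VS.
    by apply: contra nI => IV; rewrite eqEsubv VI.
  by rewrite mem_colon; exists b.
apply/vspaceP=> a; rewrite memvf.
have [c] := maximal_submod_add (act M a x) VV bV.
rewrite -actMx -actBl -mem_colon => /(subvP VI) h.
by rewrite -[a](subrK (c * b)) memvD // left_idealMl.
Qed.

(** For x outside V the left ideal of all a with a x in V is maximal, hence
    contains the radical. *)
Lemma jacobson_sub_max M (V : submod M) a x : maximal_submod V -> a \in J ->
  act M a x \in (V : {vspace M}).
Proof.
move=> Vmax aJ; case: (boolP (x \in (V : {vspace M}))) => [xV|xV].
  exact: submodP.
by rewrite -mem_colon; move/jacobsonP: aJ; apply; apply: colon_maximal.
Qed.

(** The radical is a two-sided ideal. *)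
Lemma jacobsonMr a x : x \in J -> x * a \in J.
Proof.
move=> xJ; apply/jacobsonP => I Imax.
by have := @jacobson_sub_max (regular A) I x a Imax xJ; rewrite regularE.
Qed.

Lemma max_submod_ex M (U : submod M) : (U : {vspace M}) <> fullv ->
  exists2 V : submod M, maximal_submod V & ((U : {vspace M}) <= V)%VS.
Proof.
move=> nU; pose Q k := `[< exists V : submod M,
  [/\ (V : {vspace M}) <> fullv, ((U : {vspace M}) <= V)%VS & \dim V = k] >].
have exQ : exists k, Q k by exists (\dim U); apply/asboolP; exists U.
have bQ k : Q k -> (k <= \dim {:M})%N.
  by case/asboolP => V [_ _ <-]; rewrite dimvS ?subvf.
case: (ex_maxnP exQ bQ) => k /asboolP[V [Vf UV dV]] maxk.
exists V => //; split=> // W VW; have [Wf|Wf] := pselect ((W : {vspace M}) = fullv).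
  by right.
left; apply/eqP; rewrite eq_sym eqEdim VW dV maxk //; apply/asboolP.
by exists W; split=> //; apply: subv_trans VW.
Qed.

(** Nakayama's lemma. A proper submodule lies in a maximal one, which contains
    the radical. *)
Lemma nakayama M (U : submod M) :
  (U + rad M)%VS = fullv -> (U : {vspace M}) = fullv.
Proof.
move=> Urad; apply: contrapT => /max_submod_ex[V Vmax UV].
case: (Vmax) => Vf _; apply: Vf; apply/eqP; rewrite eqEsubv subvf -Urad.
rewrite subv_add UV; apply/actv_subP => a x aJ _; exact: jacobson_sub_max.
Qed.

Lemma memv_rad M a x : a \in J -> act M a x \in (rad M : {vspace M}).
Proof. by move=> aJ; rewrite memv_act ?memvf. Qed.

(** The usual second form of Nakayama's lemma: U = J U implies U = 0. *)
Lemma nakayama0 M (U : submod M) :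
  ((U : {vspace M}) <= actv J U)%VS -> (U : {vspace M}) = 0%VS.
Proof.
move=> UJU; pose N := submodule U.
have z_st (a : A) (x : N) :
    x \in (0 : {vspace N})%VS -> act N a x \in (0 : {vspace N})%VS.
  by rewrite !memv0 => /eqP ->; rewrite linear0.
have radN : (submod_of z_st + rad N)%VS = fullv.
  apply/eqP; rewrite eqEsubv subvf; apply: subv_trans (addvSr _ _).
  have JU : (actv J U <= linfun (@vsval _ _ U) @: (rad N : {vspace N}))%VS.
    apply/actv_subP=> a x aJ xU.
    have -> : act M a x = linfun (@vsval _ _ U) (act N a (vsproj U x)).
      by rewrite lfunE /= sub_actE vsprojK.
    by apply: memv_img; apply: (@memv_rad N).
  apply/subvP=> u _.
  have /memv_imgP[v vr] := subvP JU _ (subvP UJU _ (subvsP u)).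
  by rewrite lfunE /= => /subvs_inj ->.
have full0 := nakayama radN; apply/eqP; rewrite -subv0; apply/subvP=> x xU.
have : vsproj U x \in (submod_of z_st : {vspace N}) by rewrite full0 memvf.
by rewrite !memv0 => /eqP /(congr1 vsval); rewrite vsprojK // => ->; rewrite linear0.
Qed.

(** The powers of the radical, with the whole algebra as zeroth power. *)
Definition jpow h : {vspace A} := (J ^+ h * {:A})%VS.

Lemma jpow0 : jpow 0 = fullv.
Proof. by rewrite /jpow expv0 prod1v. Qed.

Lemma jpowS h : jpow h.+1 = (J * jpow h)%VS.
Proof. by rewrite /jpow expvSl prodvA. Qed.

Lemma jpow_mulr h x w : x \in jpow h -> w \in J -> x * w \in jpow h.+1.
Proof.
move=> xh wJ; have : x * w \in (jpow h * J)%VS by rewrite memv_mul.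
apply: subvP; rewrite /jpow expvSr -!prodvA prodvSr //.
apply: (@subv_trans _ _ J).
  by apply/prodvP => a b _ bJ; apply: jacobsonMl.
by apply/subvP=> b bJ; rewrite -[b]mulr1 memv_mul ?memvf.
Qed.

Lemma jpow_sub h : (jpow h.+1 <= jpow h)%VS.
Proof.
elim: h => [|h IH]; first by rewrite jpow0 subvf.
by rewrite [X in (X <= _)%VS]jpowS [X in (_ <= X)%VS]jpowS prodvSr.
Qed.

Lemma jpow_mulfr h a x : x \in jpow h -> x * a \in jpow h.
Proof.
move=> xh; have : x * a \in (jpow h * {:A})%VS by rewrite memv_mul ?memvf.
by apply: subvP; rewrite /jpow -prodvA prodvSr ?subvf.
Qed.

Lemma jpow_mono h1 h2 : (h1 <= h2)%N -> (jpow h2 <= jpow h1)%VS.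
Proof.
move=> /subnK <-; elim: (h2 - h1)%N => [|k IH]; first exact: subvv.
exact: subv_trans (jpow_sub _) IH.
Qed.

Lemma jpow_stable h a x : x \in jpow h -> a * x \in jpow h.
Proof.
case: h => [|h]; first by rewrite jpow0 !memvf.
move=> xh; have := memv_mul (memvf a) xh; apply: subvP.
rewrite jpowS prodvA prodvSl //.
by apply/prodvP => c b _ bJ; apply: jacobsonMl.
Qed.

(** The radical is nilpotent. *)
Lemma jpow_nilp : exists h, jpow h = 0%VS.
Proof.
have Jst h (a x : A) : x \in (jpow h : {vspace regular A}) ->
    act (regular A) a x \in (jpow h : {vspace regular A}).
  by rewrite regularE; apply: jpow_stable.
have dec h : (\dim (jpow h) <= \dim {:A} - h)%N.
  elim: h => [|h IH]; first by rewrite subn0 dimvS ?subvf.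
  have [z|nz] := eqVneq (jpow h) 0%VS.
    have /eqP -> : jpow h.+1 == 0%VS by rewrite -subv0 -z jpow_sub.
    by rewrite dimv0.
  rewrite subnS -ltnS.
  have lt : (\dim (jpow h.+1) < \dim (jpow h))%N.
    rewrite ltn_neqAle dimvS ?jpow_sub // andbT.
    rewrite (dimv_leqif_eq (jpow_sub h)); apply: contraNneq nz => e.
    apply/eqP; have /= N0 := @nakayama0 (regular A) (@submod_of _ _ (regular A) _ (Jst h)).
    apply: N0; rewrite -{1}e jpowS; apply/prodvP => a b aJ bh.
    by rewrite -[a * b]regularE; apply: (@memv_act _ _ (regular A)).
  have d0 : (0 < \dim {:A} - h)%N.
    by apply: leq_trans IH; rewrite lt0n dimv_eq0.
  by rewrite prednK //; apply: leq_trans IH.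
exists (\dim {:A}); apply/eqP; rewrite -dimv_eq0 -leqn0.
by have := dec (\dim {:A}); rewrite subnn.
Qed.

End Radical.

(** * Primitive idempotents *)

Section Idempotents.
Variables (K : fieldType) (A : falgType K).
Local Notation J := (jacobson A).

Lemma mem_Ae (e a : A) : idempotent_elt e ->
  a \in (Ae e : {vspace A}) <-> a * e = a.
Proof.
move=> ee; split=> [/memv_cosetP[b _ ->]|<-]; first by rewrite -mulrA ee.
by rewrite memv_mul ?memvf ?memv_line.
Qed.

Lemma mem_Je (e a : A) : idempotent_elt e ->
  a \in (Je e : {vspace A}) <-> a \in J /\ a * e = a.
Proof.
move=> ee; split=> [/memv_cosetP[b bJ ->]|[aJ <-]].
  by rewrite -mulrA ee; split=> //; apply: jacobsonMr.
by rewrite memv_mul ?memv_line.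
Qed.

Lemma idempotent_notin_jacobson (e : A) :
  idempotent_elt e -> e \in J -> e = 0.
Proof.
move=> ee eJ; have /= N0 := @nakayama0 _ _ (regular A) (Ae e).
have e_Ae : e \in (Ae e : {vspace A}) by apply/mem_Ae.
apply/eqP; rewrite -memv0 -N0 //; apply/subvP=> a /mem_Ae-/(_ ee) <-.
rewrite -{1}ee mulrA -[_ * _ * e]regularE; apply: (@memv_act _ _ (regular A)) => //.
exact: jacobsonMl.
Qed.

Lemma powers_dependent (y : A) :
  exists2 q : {poly K}, q != 0 & horner_alg y q = 0.
Proof.
pose X := [tuple y ^+ i | i < (\dim {:A}).+1].
have nf : ~~ free X.
  apply/negP; rewrite /free size_tuple => /eqP d.
  by have := dimvS (subvf <<X>>%VS); rewrite d ltnn.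
have [k [kX [i ki]]] : exists k : 'I_(\dim {:A}).+1 -> K,
    \sum_i k i *: X`_i = 0 /\ exists i, k i != 0.
  apply: contrapT => no; case/negP: nf; apply/freeP => k kX i.
  by apply/eqP; apply: contraT => ki; case: no; exists k; split=> //; exists i.
exists (\sum_i k i *: 'X^i).
  apply: contraNneq ki => /(congr1 (fun p : {poly K} => p`_i)).
  rewrite coef0 coef_sum (bigD1 i) //= coefZ coefXn eqxx mulr1 big1 ?addr0 //=.
    by move=> ->.
  move=> j ji; rewrite coefZ coefXn; case: eqP => [e|]; last by rewrite mulr0.
  by case/eqP: ji; apply: val_inj.
rewrite linear_sum -[RHS]kX; apply: eq_bigr => j _.
rewrite linearZ /= rmorphXn /= horner_algX mulr_algl; congr (_ *: _).
by rewrite (nth_map j) ?size_enum_ord // nth_ord_enum.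
Qed.

(** Fitting's lemma in a finite dimensional algebra. *)
Lemma fitting (y : A) : exists m b,
  [/\ (0 < m)%N, b * y = y * b & y ^+ m = b * y ^+ m * y ^+ m].
Proof.
have [q q0 qy] := powers_dependent y.
(* Write q = r X^m with r.[0] != 0; then q(y) = 0 expresses y^m as a multiple
   of y^(m+1). *)
have [m [r /implyP/(_ q0) r0 qE]] := multiplicity_XsubC q 0.
have [r1 r1E] : exists r1, r - (r.[0])%:P = r1 * 'X.
  have /factor_theorem[r1 ->] : root (r - (r.[0])%:P) 0 by rewrite /root !hornerE subrr.
  by exists r1; rewrite subr0.
pose g := - (r.[0])^-1 *: horner_alg y r1.
have comm p : horner_alg y p * y = y * horner_alg y p.
  by have := congr1 (horner_alg y) (mulrC p 'X); rewrite !rmorphM /= horner_algX.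
have gy : g * y = y * g by rewrite -scalerAl -scalerAr comm.
have ym : y ^+ m = g * y ^+ m.+1.
  have : horner_alg y (r1 * 'X + r.[0]%:P) * y ^+ m = 0.
    by rewrite -r1E subrK -qy qE subr0 rmorphM rmorphXn /= horner_algX.
  rewrite rmorphD rmorphM /= horner_algC horner_algX mulrDl mulr_algl.
  move=> /eqP; rewrite addr_eq0 => /eqP E.
  rewrite /g exprS mulrA -!scalerAl E scaleNr scalerN opprK.
  by rewrite scalerA mulVf ?scale1r.
have yk k : y ^+ m = g ^+ k * y ^+ (m + k).
  elim: k => [|k IH]; first by rewrite mul1r addn0.
  by rewrite {1}ym (exprSr y m) IH -mulrA -exprSr -addnS mulrA -exprS.
have comk k : g ^+ k * y = y * g ^+ k.
  by apply/commr_sym/commrX/commr_sym.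
exists m.+1, (g ^+ m.+1); split=> //.
by rewrite -mulrA -exprD addSn (exprSr y m) {1}(yk m.+1) -mulrA -exprSr.
Qed.

(** The ring e A e of a primitive idempotent is local: by Fitting's lemma each of
    its elements is nilpotent or invertible. *)
Lemma primitive_dichotomy (e y : A) : primitive_idempotent e ->
  e * y = y -> y * e = y ->
  (exists m, y ^+ m = 0) \/ (exists b, b * y = e).
Proof.
case=> ee _ eprim ey ye; have [m [b [m0 by_ ym]]] := fitting y.
case: m m0 ym => // m _ ym.
have bm : b * y ^+ m.+1 = y ^+ m.+1 * b by apply/commrX.
set f := b * y ^+ m.+1.
have ff : f * f = f by rewrite {2}/f bm mulrA -ym -bm.
have ef : e * f = f by rewrite /f bm exprS !mulrA ey.
have fe : f * e = f by rewrite /f exprSr -!mulrA ye.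
have fy : f * y ^+ m.+1 = y ^+ m.+1 by rewrite -ym.
(* The idempotent f of e A e is 0, and y is nilpotent, or e, and y is
   invertible. *)
have [| | | |/=|f0|/eqP] := eprim f (e - f); rewrite /idempotent_elt //.
- by rewrite mulrBl !mulrBr ff ef fe ee subrr subr0.
- by rewrite mulrBr fe ff subrr.
- by rewrite mulrBl ef ff subrr.
- by rewrite addrC subrK.
- by left; exists m.+1; rewrite -fy f0 mul0r.
by rewrite subr_eq0 => /eqP ->; right; exists (b * y ^+ m); rewrite -mulrA -exprSr.
Qed.

(** If x is outside a maximal left ideal I, then 1 - b x lies in I for some b, and
    so does 1 - (b x)^m for all m; hence b x is not nilpotent. *)
Lemma nilpotent_in_jacobson (x : A) :
  (forall a, exists m, (a * x) ^+ m = 0) -> x \in J.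
Proof.
move=> xn; apply/jacobsonP => I [If Imax].
have [//|xI] := boolP (x \in (I : {vspace A})).
have [b] := @maximal_submod_add _ _ (regular A) I x 1 (conj If Imax) xI.
rewrite regularE => bI.
have [m bm] := xn b.
have I1 k : 1 - (b * x) ^+ k \in (I : {vspace A}).
  elim: k => [|k IH]; first by rewrite subrr mem0v.
  rewrite exprSr; set u := (b * x) ^+ k.
  have -> : 1 - u * (b * x) = 1 - u + u * (1 - b * x).
    by rewrite mulrBr mulr1 addrA subrK.
  by rewrite memvD // left_idealMl.
case: If; apply/vspaceP=> a; rewrite memvf -[a]mulr1; apply: left_idealMl.
by have := I1 m; rewrite bm subr0.
Qed.

(** The radical of A e is its only maximal submodule: every x in A e that does
    not generate A e is radical. *)
Lemma primitive_not_linv_jacobson (e x : A) : primitive_idempotent e ->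
  x * e = x -> (forall b, b * x <> e) -> x \in J.
Proof.
move=> ep xe nb; have [ee _ _] := ep; apply: nilpotent_in_jacobson => a.
have [| |[m ym]|[b bE]] := primitive_dichotomy (y := e * a * x) ep.
- by rewrite !mulrA ee.
- by rewrite -mulrA xe.
- exists m.+1; rewrite exprS -mulrA.
  suff -> : x * (a * x) ^+ m = x * (e * a * x) ^+ m by rewrite ym !mulr0.
  elim: m {ym} => [|m IH]; first by rewrite !expr0.
  by rewrite !exprS -(mulrA a) IH !mulrA xe.
by case: (nb (b * (e * a))); rewrite -mulrA.
Qed.

End Idempotents.

Section BasicAlgebra.

(** Over an algebraically closed field the local ring e A e has residue field
    K. *)
Lemma primitive_residue (K : closedFieldType) (A : falgType K) (e x : A) :
  primitive_idempotent e -> e * x = x -> x * e = x ->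
  exists k, x - k *: e \in jacobson A.
Proof.
move=> ep ex xe; have [ee e0 _] := ep.
suff [k [v [v0 ev xv]]] : exists k v, [/\ v <> 0, e * v = v & x * v = k *: v].
  exists k; apply: (primitive_not_linv_jacobson ep).
    by rewrite mulrBl xe -scalerAl ee.
  move=> b bx; apply: v0; rewrite -ev -bx -mulrA mulrBl xv -scalerAl ev.
  by rewrite subrr mulr0.
have [q q0 qx] := powers_dependent x.
have [rs qE] := closed_field_poly_normal q.
have : horner_alg x (\prod_(z <- rs) ('X - z%:P)) * e = 0.
  move: qx; rewrite {1}qE linearZ /= mulr_algl => /eqP.
  by rewrite scaler_eq0 lead_coef_eq0 (negPf q0) => /eqP ->; rewrite mul0r.
suff H w : w <> 0 -> e * w = w ->
    horner_alg x (\prod_(z <- rs) ('X - z%:P)) * w = 0 ->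
    exists k v, [/\ v <> 0, e * v = v & x * v = k *: v] by apply: H.
elim: rs w {qE} => [|r rs IH] w w0 ew.
  by rewrite big_nil rmorph1 mul1r => /w0.
rewrite big_cons mulrC rmorphM -mulrA rmorphB /= horner_algX horner_algC => xw.
have [z|nz] := pselect ((x - r%:A) * w = 0); last first.
  apply: (IH _ nz _ xw).
  by rewrite mulrA mulrBr mulr_algr ex mulrBl -scalerAl ew mulrBl mulr_algl.
exists r, w; split=> //; apply/eqP; rewrite -subr_eq0 -[r *: w]mulr_algl.
by rewrite -mulrBl z.
Qed.

(** In a basic algebra the elements of e_i A e_k with i distinct from k are
    radical. *)
Lemma basic_offdiag (K : fieldType) (A : falgType K) (n : nat) (e : 'I_n -> A)
    (i k : 'I_n) (x : A) :
  full_primitive_idempotents e -> basic e -> i != k ->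
  e i * x = x -> x * e k = x -> x \in jacobson A.
Proof.
case=> ep _ _ be ik ex xe; have [[eei ei0 epi] [eek ek0 _]] := (ep i, ep k).
apply: (primitive_not_linv_jacobson (ep k)) => // b bx.
pose y := e k * b * e i.
have yx : y * x = e k by rewrite /y -mulrA ex -mulrA bx eek.
have eky : e k * y = y by rewrite /y !mulrA eek.
have yei : y * e i = y by rewrite /y -mulrA eei.
have ff : x * y * (x * y) = x * y by rewrite mulrA -(mulrA x y x) yx xe.
have xyE : x * y = e i.
  have [| | | |/=|f0|/eqP] := epi (x * y) (e i - x * y).
  - exact: ff.
  - by rewrite /idempotent_elt mulrBl !mulrBr eei ff mulrA ex -mulrA yei subrr subr0.
  - by rewrite mulrBr ff -mulrA yei subrr.
  - by rewrite mulrBl ff mulrA ex subrr.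
  - by rewrite addrC subrK.
  - case: ek0; rewrite -[e k]yx -[in LHS]eky -[e k]yx -mulrA -mulrA (mulrA x).
    by rewrite f0 mul0r mulr0.
  by rewrite subr_eq0 => /eqP.
(* As x y = e_i and y x = e_k, multiplication by x is an isomorphism from A e_i
   to A e_k. *)
case/eqP: ik; apply: be.
pose f : 'Hom(submodule (Ae (e i)), submodule (Ae (e k))) :=
  (linfun (vsproj (Ae (e k))) \o amulr x \o linfun (@vsval _ _ (Ae (e i))))%VF.
pose g : 'Hom(submodule (Ae (e k)), submodule (Ae (e i))) :=
  (linfun (vsproj (Ae (e i))) \o amulr y \o linfun (@vsval _ _ (Ae (e k))))%VF.
have fE u : vsval (f u) = vsval u * x.
  rewrite !comp_lfunE !lfunE /= vsprojK //; apply/mem_Ae => //.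
  by rewrite -mulrA xe.
have gE u : vsval (g u) = vsval u * y.
  rewrite !comp_lfunE !lfunE /= vsprojK //; apply/mem_Ae => //.
  by rewrite -mulrA yei.
exists f; split.
  move=> a u; apply: subvs_inj; rewrite fE !sub_actE fE.
  by rewrite !regularE mulrA.
exists g => u; apply: subvs_inj.
  by rewrite gE fE -mulrA xyE; apply/mem_Ae => //; apply: subvsP.
by rewrite fE gE -mulrA yx; apply/mem_Ae => //; apply: subvsP.
Qed.

End BasicAlgebra.

(** * Sums of cyclic modules in terms of generators *)

Section Subquotients.
Variables (K : fieldType) (A : falgType K) (M : fdmod A) (U W : submod M).

(** The representative in U of a class of U / W. *)
Definition sq_rep (u : subquotient U W) : M := vsval (vsval u).

Fact sq_rep_linear : linear sq_rep.
Proof. by []. Qed.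
HB.instance Definition _ :=
  GRing.isLinear.Build K (subquotient U W) M _ sq_rep sq_rep_linear.

(** The class in U / W of an element of U. *)
Definition sq_class (x : M) : subquotient U W :=
  quot_proj (Submod (restrict_stable U W)) (vsproj U x).

Lemma sq_repP u : sq_rep u \in (U : {vspace M}).
Proof. exact: subvsP. Qed.

Lemma mem_restrict (v : submodule U) :
  (v \in (Submod (restrict_stable U W) : {vspace submodule U})) =
  (vsval v \in (W : {vspace M})).
Proof. by rewrite /= -memv_preim lfunE. Qed.

Lemma sq_rep_class x : x \in (U : {vspace M}) ->
  sq_rep (sq_class x) - x \in (W : {vspace M}).
Proof.
move=> xU; have := quot_proj_valB (Submod (restrict_stable U W)) (vsproj U x).
by rewrite mem_restrict linearB /= vsprojK.
Qed.

Lemma sq_rep_act a u :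
  sq_rep (act (subquotient U W) a u) - act M a (sq_rep u) \in (W : {vspace M}).
Proof.
pose R := Submod (restrict_stable U W).
have repB x : sq_rep (quot_proj R x) - vsval x \in (W : {vspace M}).
  by have := quot_proj_valB R x; rewrite mem_restrict linearB.
have [v ->] := quot_surj u; rewrite -quot_hom.
have h1 := repB (act (submodule U) a v).
have h2 := @submodP _ _ M W a _ (repB v).
have := memvB h1 h2; rewrite [act (submodule U) a v]/= sub_actE.
by rewrite (linearB (act M a)) opprB addrA subrK.
Qed.

Lemma sq_rep_eq0 u : sq_rep u \in (W : {vspace M}) -> u = 0.
Proof. by rewrite -mem_restrict -quot_proj_eq0 quot_proj_val => /eqP. Qed.

End Subquotients.

Lemma dsum_actE (K : fieldType) (A : falgType K) (n : nat)
    (M : 'I_n -> fdmod A) a (d : dsum M) i :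
  (act (dsum M) a d : dsum M) i = act (M i) a (d i).
Proof. by rewrite lfunE /= ffunE. Qed.

Section Generators.
Variables (K : fieldType) (A : falgType K) (n : nat) (e : 'I_n -> A).
Variable t : 'I_n -> nat.
Hypothesis ee : forall i, idempotent_elt (e i).

(** The index set of the generators: pairs (i, j) with j < t_i. *)
Definition slot := {i : 'I_n & 'I_(t i)}.
Implicit Type C : forall i : 'I_n, 'I_(t i) -> left_ideal A.

(** The direct sum of the modules A e_i / C_ij. *)
Definition cyclic_sum C : fdmod A :=
  dsum (fun i : 'I_n => dsum (fun j : 'I_(t i) =>
    subquotient (Ae (e i)) (C i j))).

(** A family z_s indexed by the slots s = (i, j) presents M by C if it generates
    M, each z_s lies in e_i M, and the relations between the z_s are spanned by
    the relations c z_s = 0 with c in C_s. *)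
Definition presents (M : fdmod A) C (z : slot -> M) :=
  [/\ forall s, act M (e (tag s)) (z s) = z s,
      forall x, exists a : slot -> A, x = \sum_s act M (a s) (z s) &
      forall a : slot -> A, \sum_s act M (a s) (z s) = 0 <->
        forall s, a s * e (tag s) \in (C (tag s) (tagged s) : {vspace A})].

Section FromSum.
Variable C : forall i : 'I_n, 'I_(t i) -> left_ideal A.
Local Notation D := (cyclic_sum C).

(** The component of d at s, as an element of A e_i / C_ij for s = (i, j). *)
Definition dcomp (d : D) (s : slot) :
  subquotient (Ae (e (tag s))) (C (tagged s)) := d (tag s) (tagged s).

Lemma dcompD (d d' : D) s : dcomp (d + d') s = dcomp d s + dcomp d' s.
Proof. by rewrite /dcomp /= !ffunE. Qed.

Lemma dcompZ k (d : D) s : dcomp (k *: d) s = k *: dcomp d s.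
Proof. by rewrite /dcomp /= !ffunE. Qed.

Lemma dcomp0 s : dcomp 0 s = 0.
Proof. by rewrite /dcomp /= !ffunE. Qed.

Lemma dcomp_act a (d : D) s : dcomp (act D a d) s = act _ a (dcomp d s).
Proof. by rewrite /dcomp !dsum_actE. Qed.

Lemma dcomp_inj (d d' : D) : (forall s, dcomp d s = dcomp d' s) -> d = d'.
Proof.
move=> h; apply/ffunP=> i; apply/ffunP=> j.
exact: (h (Tagged (fun i => 'I_(t i)) j)).
Qed.

(** The element of the direct sum with given components. *)
Definition mk_sum (f : forall s : slot,
    subquotient (Ae (e (tag s))) (C (tagged s))) : D :=
  [ffun i => [ffun j => f (Tagged (fun i => 'I_(t i)) j)]].

Lemma dcomp_mk f s : dcomp (mk_sum f) s = f s.
Proof. by case: s => i j; rewrite /dcomp /= !ffunE. Qed.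

(** The class of e_i in A e_i / C_ij. *)
Definition gen_class (s : slot) :
    subquotient (Ae (e (tag s))) (C (tagged s)) :=
  @sq_class _ _ (regular A) (Ae (e (tag s))) (C (tagged s)) (e (tag s)).

Lemma rep_gen_class s :
  sq_rep (gen_class s) - e (tag s) \in (C (tagged s) : {vspace A}).
Proof.
by apply: (@sq_rep_class _ _ (regular A)); apply/mem_Ae; apply: ee.
Qed.

(** The same class as an element of the direct sum. *)
Definition std_gen (s : slot) : D :=
  mk_sum (fun s' => if s' == s then gen_class s' else 0).

Lemma rep_Ae (s : slot) (u : subquotient (Ae (e (tag s))) (C (tagged s))) :
  sq_rep u * e (tag s) = sq_rep u.
Proof. by apply/mem_Ae; [exact: ee | exact: (@sq_repP _ _ (regular A))]. Qed.

Lemma dcomp_std (a : slot -> A) s :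
  dcomp (\sum_s' act D (a s') (std_gen s')) s =
  act _ (a s) (gen_class s).
Proof.
rewrite (big_morph (fun d => dcomp d s) (fun d d' => dcompD d d' s) (dcomp0 s)).
rewrite (bigD1 s) //= dcomp_act dcomp_mk eqxx big1 ?addr0 // => s' ss'.
by rewrite dcomp_act dcomp_mk eq_sym (negPf ss') linear0.
Qed.

Lemma rep_std (a : slot -> A) s :
  sq_rep (dcomp (\sum_s' act D (a s') (std_gen s')) s) - a s * e (tag s)
  \in (C (tagged s) : {vspace A}).
Proof.
rewrite dcomp_std; have h1 := sq_rep_act (a s) (gen_class s).
rewrite regularE in h1.
have := memvD h1 (left_idealMl (a s) (rep_gen_class s)).
by rewrite mulrBr addrA subrK.
Qed.

Lemma std_presents : presents C std_gen.
Proof.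
split=> [s|d|a].
- apply: dcomp_inj => s'; rewrite dcomp_act dcomp_mk; case: eqP => [->|_]; last first.
    by rewrite linear0.
  apply/eqP; rewrite -subr_eq0; apply/eqP; apply: sq_rep_eq0.
  rewrite linearB /=; have h2 := rep_gen_class s.
  have h1 := sq_rep_act (e (tag s)) (gen_class s); rewrite regularE in h1.
  have := memvD h1 (memvB (left_idealMl (e (tag s)) h2) h2).
  by rewrite mulrBr ee opprB [X in _ + X]addrA subrK addrA subrK.
- exists (fun s => sq_rep (dcomp d s)); apply: dcomp_inj => s.
  apply/eqP; rewrite -subr_eq0 -opprB oppr_eq0; apply/eqP.
  apply: sq_rep_eq0; rewrite linearB /=.
  by have := rep_std (fun s => sq_rep (dcomp d s)) s; rewrite /= rep_Ae.
split=> [d0 s|aC].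
  by have := rep_std a s; rewrite d0 dcomp0 linear0 sub0r memvN.
apply: dcomp_inj => s; rewrite dcomp0; apply: sq_rep_eq0.
by rewrite -[sq_rep _](subrK (a s * e (tag s))) memvD ?rep_std ?aC.
Qed.

Variables (M : fdmod A) (z : slot -> M).

Definition sum_fun (d : D) : M := \sum_s act M (sq_rep (dcomp d s)) (z s).

Fact sum_fun_linear : linear sum_fun.
Proof.
move=> k d d'; rewrite /sum_fun scaler_sumr -big_split /=; apply: eq_bigr => s _.
by rewrite dcompD dcompZ sq_rep_linear actDl actZl.
Qed.
HB.instance Definition _ := GRing.isLinear.Build K D M _ sum_fun sum_fun_linear.

(** The map from the direct sum of the A e_i / C_ij to M sending the standard
    generators to z. *)
Definition sum_hom : 'Hom(D, M) := linfun sum_fun.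

Lemma sum_homE d : sum_hom d = \sum_s act M (sq_rep (dcomp d s)) (z s).
Proof. by rewrite lfunE. Qed.

Hypothesis ez : forall s, act M (e (tag s)) (z s) = z s.
Hypothesis Cz : forall s c, c \in (C (tagged s) : {vspace A}) ->
  c * e (tag s) = c -> act M c (z s) = 0.
Hypothesis zgen : forall x, exists a : slot -> A, x = \sum_s act M (a s) (z s).

Lemma sum_hom_is_hom : is_hom sum_hom.
Proof.
move=> a d; rewrite !sum_homE linear_sum; apply: eq_bigr => s _.
rewrite /=; apply/eqP; rewrite -subr_eq0 dcomp_act -actMx -actBl; apply/eqP; apply: Cz.
  by have := sq_rep_act a (dcomp d s); rewrite regularE.
by rewrite mulrBl -mulrA !rep_Ae.
Qed.

Lemma sum_hom_std a : sum_hom (\sum_s act D (a s) (std_gen s)) =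
  \sum_s act M (a s) (z s).
Proof.
rewrite sum_homE; apply: eq_bigr => s _; apply/eqP.
rewrite -subr_eq0 -{2}ez -actMx -actBl; apply/eqP; apply: Cz.
  exact: rep_std.
by rewrite mulrBl rep_Ae -mulrA ee.
Qed.

Lemma sum_hom_surj x : exists d, x = sum_hom d.
Proof.
by have [a ->] := zgen x; exists (\sum_s act D (a s) (std_gen s)); rewrite sum_hom_std.
Qed.

(** A generating family satisfying the relations C presents M as soon as the
    dimensions agree. *)
Lemma presents_dim : \dim {:M} = \dim {:D} -> presents C z.
Proof.
move=> dMD; have [_ _ stdC] := std_presents; split=> // a.
have := bij_lfun_surj_dim sum_hom_surj (esym dMD); move/bij_inj => hinj.
rewrite -stdC -sum_hom_std; split=> [h|->]; last by rewrite linear0.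
by apply: hinj; rewrite h linear0.
Qed.

End FromSum.

(** In a presentation the relations c z_s = 0 with c in C_s hold. *)
Lemma presents_kill C (M : fdmod A) (z : slot -> M) s c :
  presents C z -> c \in (C _ (tagged s) : {vspace A}) ->
  c * e (tag s) = c -> act M c (z s) = 0.
Proof.
case=> _ _ zC cC ce; have /zC : forall s', (if s' == s then c else 0) * e (tag s') \in
    (C _ (tagged s') : {vspace A}).
  by move=> s'; case: eqP => [->|_]; rewrite ?ce // mul0r mem0v.
rewrite (bigD1 s) //= eqxx big1 ?addr0 // => s' /negPf ->.
by rewrite act0l.
Qed.

(** M is isomorphic to the direct sum of the A e_i / C_ij exactly if it is
    presented by C. *)
Lemma presents_iso (M : fdmod A) C : (exists z : slot -> M, presents C z) <->
  iso M (cyclic_sum C).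
Proof.
split=> [[z [ez zgen zC]]|/iso_sym[f [fh fb]]].
  have Cz s c := @presents_kill C M z s c (And3 ez zgen zC).
  apply: iso_sym; exists (sum_hom C z); split; first exact: sum_hom_is_hom.
  apply: bij_lfun => [d|]; last exact: sum_hom_surj.
  rewrite sum_homE => /zC dC; apply: dcomp_inj => s; rewrite dcomp0.
  by apply: sq_rep_eq0; rewrite -rep_Ae.
have [ez zgen zC] := std_presents C.
have fsum a : f (\sum_s act _ (a s) (std_gen C s)) =
    \sum_s act M (a s) (f (std_gen C s)).
  by rewrite linear_sum; apply: eq_bigr => s _; rewrite -fh.
exists (fun s => f (std_gen C s)); split=> [s|x|a].
- by rewrite -fh ez.
- case: (fb) => g fK gK; have [a E] := zgen (g x).
  by exists a; rewrite -fsum -E gK.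
rewrite -fsum -zC; split=> [h|->]; last by rewrite linear0.
by apply: (bij_inj fb); rewrite h linear0.
Qed.

End Generators.

(** * Semicontinuity under degeneration *)

(** The rank of a linear map depending linearly on a parameter can only drop on
    passing to the Zariski closure. *)
Lemma rank_semicontinuous (K : fieldType) (V U W : vectType K)
    (S : V -> Prop) (x : V) (phi : {linear V -> 'Hom(U, W)}) (r : nat) :
  zariski_closure S x ->
  (forall y, S y -> (\dim (limg (phi y)) <= r)%N) ->
  (\dim (limg (phi x)) <= r)%N.
Proof.
move=> Sx Sr; rewrite leqNgt; apply/negP => rd.
set d := \dim (limg (phi x)) in rd.
pose X := vbasis (limg (phi x)); pose u (i : 'I_d) := (phi x)^-1%VF X`_i.
have xu i : phi x (u i) = X`_i.
  by apply: limg_lfunVK; apply: vbasis_mem; rewrite mem_nth ?size_tuple.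
(* The minor of g given by the vectors u_i and the coordinates along X. *)
pose N (g : 'Hom(U, W)) : 'M[K]_d := \matrix_(i, j) coord X j (g (u i)).
have N_lin g k h : N (k *: g + h) = k *: N g + N h.
  by apply/matrixP=> i j; rewrite !mxE add_lfunE scale_lfunE linearP.
have N0 : N 0 = 0 by apply/matrixP=> i j; rewrite !mxE zero_lfunE linear0.
have Nx : N (phi x) = 1%:M.
  apply/matrixP=> i j; rewrite !mxE xu coord_free ?(basis_free (vbasisP _)) //.
have detS y : S y -> \det (N (phi y)) = 0.
  move=> Sy; apply/eqP; apply: contraTT (Sr _ Sy) => det0; rewrite -ltnNge.
  have Nunit : N (phi y) \in unitmx by rewrite unitmxE unitfE.
  apply: leq_trans rd _.
  pose Y := [tuple phi y (u i) | i < d].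
  have Yi (i : 'I_d) : Y`_i = phi y (u i) by rewrite -tnth_nth tnth_mktuple.
  have /freeP : forall k, \sum_(i < d) k i *: Y`_i = 0 -> forall i, k i = 0.
    move=> k kY; pose kr : 'rV[K]_d := \row_i k i.
    have krN : kr *m N (phi y) = 0.
      apply/rowP=> j; rewrite !mxE -[RHS](linear0 (coord X j)) -kY linear_sum.
      by apply: eq_bigr => i _; rewrite !mxE Yi linearZ.
    move=> i; have -> : k i = kr 0 i by rewrite mxE.
    by rewrite -[kr](mulmxK Nunit) krN mul0mx mxE.
  rewrite /free => /eqP; rewrite size_tuple => <-; apply: dimvS.
  apply/span_subvP => _ /(tnthP Y)[i ->]; rewrite tnth_mktuple.
  by rewrite memv_img ?memvf.
pose b := vbasis {:V}.
(* The determinant of this minor as a polynomial in the coordinates of y. *)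
pose P : {mpoly K[\dim {:V}]} :=
  \det (\matrix_(i < d, j < d) \sum_(k < \dim {:V}) ((N (phi b`_k)) i j)%:MP * 'X_k).
have PE y : P.@[affine_coord y] = \det (N (phi y)).
  rewrite /P -det_map_mx; congr (\det _); apply/matrixP => i j.
  rewrite mxE mxE rmorph_sum /= {2}(coord_vbasis (memvf y)).
  rewrite (big_morph phi (linearD phi) (linear0 phi)).
  have N_add g h : N (g + h) = N g + N h by rewrite -[g]scale1r N_lin !scale1r.
  rewrite (big_morph N N_add N0) summxE; apply: eq_bigr => k _.
  rewrite mevalM mevalC mevalXU [phi (_ *: _)]linearZ /=.
  by rewrite -[_ *: phi _]addr0 N_lin N0 addr0 [RHS]mxE mulrC.
have := Sx P; rewrite PE Nx det1 => h.
have /eqP := h (fun y Sy => etrans (PE y) (detS y Sy)).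
by rewrite oner_eq0.
Qed.

Section BlockDiagonal.
Variables (K : fieldType) (n : nat) (d : 'I_n -> nat).
Local Notation N := (\sum_i d i)%N.

Lemma mulmx_ext m p (B C : 'M[K]_(m, p)) :
  (forall v : 'cV_p, B *m v = C *m v) -> B = C.
Proof.
move=> h; apply/matrixP=> i j; have := congr1 (fun v : 'cV_m => v i 0) (h (delta_mx j 0)).
by rewrite -!colE !mxE.
Qed.

Lemma mxdiag_mulcv (B : forall i, 'M[K]_(d i)) (v : 'cV[K]_N) :
  \mxdiag_i B i *m v = \mxcol_i (B i *m submxcol v i).
Proof. by rewrite -{1}[v]submxcolK mul_mxdiag_mxcol. Qed.

Lemma mxdiag_mul (B C : forall i, 'M[K]_(d i)) :
  \mxdiag_i B i *m \mxdiag_i C i = \mxdiag_i (B i *m C i).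
Proof.
apply: mulmx_ext => v; rewrite -mulmxA !mxdiag_mulcv.
by apply: eq_mxcol => i; rewrite mxcolK mulmxA.
Qed.

Lemma mxdiag_unit (B : forall i, 'M[K]_(d i)) :
  (forall i, B i \in unitmx) -> \mxdiag_i B i \in unitmx.
Proof.
move=> Bu; apply: (proj1 (mulmx1_unit (B := \mxdiag_i invmx (B i)) _)).
by rewrite mxdiag_mul -(mxdiagZ 1); apply: eq_mxdiag => i; rewrite mulmxV.
Qed.

End BlockDiagonal.

Section Degenerate.
Variables (K : fieldType) (A : falgType K).

Section Matrices.
Variable N : nat.
Implicit Type rho : 'Hom(A, 'M[K]_N).

(** The action of a on column vectors through the matrix rho a. *)
Definition mat_end rho a : 'End('cV[K]_N) := linfun (mulmx (rho a)).

Lemma mat_endE rho a v : mat_end rho a v = rho a *m v.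
Proof. by rewrite lfunE. Qed.

Fact mat_end_linear rho : linear (mat_end rho).
Proof.
move=> k a b; apply/lfunP=> v.
by rewrite add_lfunE scale_lfunE !mat_endE linearP mulmxDl scalemxAl.
Qed.
HB.instance Definition _ rho :=
  GRing.isLinear.Build K A 'End('cV[K]_N) _ (mat_end rho) (mat_end_linear rho).

(** The map sending v to the family of all rho c v with c in cs; its kernel is the
    common kernel of the rho c. *)
Definition stack_fun (cs : seq A) rho (v : 'cV[K]_N) :
    {ffun 'I_(size cs) -> 'cV[K]_N} := [ffun i => rho cs`_(i : 'I_(size cs)) *m v].

Fact stack_fun_linear cs rho : linear (stack_fun cs rho).
Proof.
by move=> k u v; apply/ffunP=> i; rewrite !ffunE linearP.
Qed.
HB.instance Definition _ cs rho := GRing.isLinear.Build K _ _ _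
  (stack_fun cs rho) (stack_fun_linear cs rho).

Definition stack cs rho : 'Hom('cV[K]_N, {ffun 'I_(size cs) -> 'cV[K]_N}) :=
  linfun (stack_fun cs rho).

Fact stack_linear cs : linear (stack cs).
Proof.
move=> k rho sigma; apply/lfunP=> v; rewrite add_lfunE scale_lfunE !lfunE /=.
apply/ffunP=> i; rewrite !ffunE add_lfunE scale_lfunE mulmxDl.
by rewrite scalemxAl.
Qed.
HB.instance Definition _ cs := GRing.isLinear.Build K _ _ _
  (stack cs) (stack_linear cs).

Lemma mem_ker_stack cs rho v :
  reflect (forall c, c \in cs -> rho c *m v = 0) (v \in lker (stack cs rho)).
Proof.
rewrite memv_ker lfunE /=; apply: (iffP eqP) => [/ffunP h c cs_c|h].
  have ic : (index c cs < size cs)%N by rewrite index_mem.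
  by have := h (Ordinal ic); rewrite !ffunE /= nth_index.
by apply/ffunP=> i; rewrite !ffunE h // mem_nth.
Qed.

End Matrices.

(** The elements of M killed by all members of cs. *)
Definition killed (M : fdmod A) (cs : seq A) : {vspace M} :=
  (\bigcap_(c <- cs) lker (act M c))%VS.

Lemma mem_killed (M : fdmod A) cs (x : M) :
  reflect (forall c, c \in cs -> act M c x = 0) (x \in killed M cs).
Proof.
rewrite /killed; elim: cs => [|c cs IH].
  by rewrite big_nil memvf; constructor.
rewrite big_cons memv_cap memv_ker; apply: (iffP andP) => [[/eqP cx /IH h] c'|h].
  by rewrite inE => /predU1P[->|/h].
split; first by rewrite h ?mem_head.
by apply/IH => c' c'cs; rewrite h // inE c'cs orbT.
Qed.

Lemma represents_killed n (d : 'I_n -> nat)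
    (rho : 'Hom(A, 'M[K]_(\sum_i d i)%N)) M cs : represents rho M ->
  \dim (lker (stack cs rho)) = \dim (killed M cs).
Proof.
case=> f [fb fact]; have finj := bij_inj fb.
have lf : lker f == 0%VS by apply/lker0P.
rewrite -(limg_dim_eq (f := f)); last by rewrite (eqP lf) capv0.
congr (\dim _); apply/vspaceP=> x.
apply/memv_imgP/mem_killed => [[v /mem_ker_stack h ->] c cc|h].
  by rewrite -fact h // linear0.
case: (fb) => g fK gK; exists (g x); last by rewrite gK.
by apply/mem_ker_stack => c cc; apply: finj; rewrite fact gK h // linear0.
Qed.

Lemma represents_rank n (d : 'I_n -> nat)
    (rho : 'Hom(A, 'M[K]_(\sum_i d i)%N)) M a : represents rho M ->
  \dim (limg (mat_end rho a)) = \dim (limg (act M a)).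
Proof.
case=> f [fb fact]; have finj := bij_inj fb.
have lf : lker f == 0%VS by apply/lker0P.
rewrite -(limg_dim_eq (f := f)); last by rewrite (eqP lf) capv0.
rewrite -limg_comp; congr (\dim _); apply/vspaceP=> x.
apply/memv_imgP/memv_imgP => [[v _ ->]|[y _ ->]].
  by exists (f v); rewrite ?memvf // comp_lfunE mat_endE fact.
case: (fb) => g fK gK; exists (g y); rewrite ?memvf //.
by rewrite comp_lfunE mat_endE fact gK.
Qed.

Variables (n : nat) (e : 'I_n -> A).

Lemma GL_orbit_represents (d : 'I_n -> nat)
    (rho sigma : 'Hom(A, 'M[K]_(\sum_i d i)%N)) M :
  represents rho M -> GL_orbit rho sigma -> represents sigma M.
Proof.
case=> f [fb fact] [g [gu sE]].
have Gu := mxdiag_unit gu; set G := \mxdiag_i g i in sE Gu.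
pose h : 'Hom('cV[K]_(\sum_i d i)%N, M) := (f \o linfun (mulmx (invmx G)))%VF.
have hE v : h v = f (invmx G *m v) by rewrite comp_lfunE lfunE.
exists h; split=> [|a v]; last by rewrite !hE sE !mulmxA mulVmx // mul1mx -mulmxA fact.
case: fb => k fK kK; exists (fun x => G *m k x) => x.
  by rewrite hE fK mulKVmx.
by rewrite hE mulKmx.
Qed.

(** The dimension of the space of elements killed by given elements of A can
    only grow under degeneration. *)
Lemma degeneration_killed (M M' : fdmod A) cs : degeneration e M M' ->
  (\dim (killed M cs) <= \dim (killed M' cs))%N.
Proof.
case=> rho [rho' [_ rM _ rM' cl]].
rewrite -(represents_killed cs rM) -(represents_killed cs rM').
set N := (\sum_i _)%N in rho rho' rM rM' cl *.
have dk (sigma : 'Hom(A, 'M[K]_N)) := limg_ker_dim (stack cs sigma) fullv.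
have := rank_semicontinuous (phi := stack cs) (r := \dim (limg (stack cs rho))) cl.
have := dk rho; have := dk rho'; rewrite !capfv => E' E.
rewrite -(leq_add2l (\dim (lker (stack cs rho')))) E' -E.
rewrite leq_add2r; apply => sigma orb.
have := dk sigma; rewrite capfv (represents_killed cs (GL_orbit_represents rM orb)).
by rewrite -(represents_killed cs rM) -E => /addnI ->.
Qed.

(** The dimension of e_i M, an entry of the dimension vector, is constant. *)
Lemma degeneration_rank (M M' : fdmod A) i : degeneration e M M' ->
  \dim (limg (act M' (e i))) = \dim (limg (act M (e i))).
Proof.
case=> rho [rho' [[_ _ rE] rM [_ _ rE'] rM' _]].
rewrite -(represents_rank _ rM) -(represents_rank _ rM').
by congr (\dim (limg _)); apply/lfunP=> v; rewrite !mat_endE rE rE'.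
Qed.

End Degenerate.

(** * Rigidity of the modules satisfying the two conditions *)

Section LinearAlgebra.
Variables (K : fieldType) (V : vectType K) (I : finType) (v : I -> V).

Lemma dim_sum_line (P : pred I) :
  (forall k : I -> K, \sum_i k i *: v i = 0 -> forall i, k i = 0) ->
  \dim (\sum_(i | P i) <[v i]>)%VS = #|P|.
Proof.
move=> indep.
have v0 i : v i != 0.
  apply/eqP=> vi0; have := indep (fun j => (j == i)%:R); rewrite (bigD1 i) //=.
  rewrite vi0 scaler0 big1 => [/(_ (addr0 _) i)|j /negPf ->]; last by rewrite scale0r.
  by rewrite eqxx => /eqP; rewrite oner_eq0.
have dir : directv (\sum_(i | P i) <[v i]>)%VS.
  apply/directv_sum_independent => us usv us0 i Pi.
  have /choice[k kE] : forall j, exists c, P j -> us j = c *: v j.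
    move=> j; case Pj: (P j); last by exists 0.
    by have /vlineP[c ->] := usv j Pj; exists c.
  have := indep (fun j => if P j then k j else 0).
  rewrite (bigID P) /= [X in _ + X]big1 => [|j /negPf ->]; last by rewrite scale0r.
  rewrite addr0 (eq_bigr us) => [/(_ us0 i)|j Pj]; last by rewrite Pj kE.
  by rewrite Pi kE // => ->; rewrite scale0r.
rewrite (directvP dir) /= -sum1_card; apply: eq_bigr => i _.
by rewrite dim_vline v0.
Qed.

Lemma dim_sum_line_leq (P : pred I) :
  (\dim (\sum_(i | P i) <[v i]>)%VS <= #|P|)%N.
Proof.
apply: leq_trans (dimv_leq_sum _ _ _) _; rewrite -sum1_card.
by apply: leq_sum => i _; rewrite dim_vline leq_b1.
Qed.

End LinearAlgebra.

Section HomogeneousParts.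
Variables (K : fieldType) (A : falgType K) (n : nat) (e : 'I_n -> A).
Hypothesis ee : forall i, idempotent_elt (e i).

(** The parts e_i M of M and e_i rad M of its radical. *)
Definition epart (M : fdmod A) i : {vspace M} := limg (act M (e i)).
Definition eradpart (M : fdmod A) i : {vspace M} := (epart M i :&: rad M)%VS.

Lemma mem_epart (M : fdmod A) i (x : M) : reflect (act M (e i) x = x) (x \in epart M i).
Proof.
apply: (iffP idP) => [/memv_imgP[y _ ->]|<-]; last by rewrite memv_img ?memvf.
by rewrite -actMx ee.
Qed.

Lemma iso_rank (M N : fdmod A) a : iso M N ->
  \dim (limg (act M a)) = \dim (limg (act N a)).
Proof.
case=> f [fh fb]; have finj := bij_inj fb.
have lf : lker f == 0%VS by apply/lker0P.
rewrite -(limg_dim_eq (f := f)); last by rewrite (eqP lf) capv0.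
rewrite -limg_comp; congr (\dim _); apply/vspaceP=> x.
apply/memv_imgP/memv_imgP => [[v _ ->]|[y _ ->]].
  by exists (f v); rewrite ?memvf // comp_lfunE fh.
case: (fb) => g fK gK; exists (g y); rewrite ?memvf //.
by rewrite comp_lfunE fh gK.
Qed.

Lemma dim_epart_top (M : fdmod A) i :
  (\dim (eradpart M i) + \dim (epart (top M) i) = \dim (epart M i))%N.
Proof.
rewrite -(limg_ker_dim (quot_proj (rad M)) (epart M i)).
apply: (congr2 addn).
  by congr (\dim (_ :&: _)%VS); apply/vspaceP=> x; rewrite memv_ker quot_proj_eq0.
congr (\dim _); apply/vspaceP=> x.
apply/memv_imgP/memv_imgP => [[y _ ->]|[_ /memv_imgP[y _ ->] ->]].
  have [z ->] := quot_surj y; exists (act M (e i) z); first by rewrite memv_img ?memvf.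
  by rewrite quot_hom.
by exists (quot_proj (rad M) y); rewrite ?memvf // -quot_hom.
Qed.

Lemma dim_eradpart_eq (M M' : fdmod A) i : iso (top M') (top M) ->
  \dim (epart M' i) = \dim (epart M i) -> \dim (eradpart M' i) = \dim (eradpart M i).
Proof.
move=> tM; have := dim_epart_top M' i; have := dim_epart_top M i.
by rewrite [\dim (epart (top M') i)](iso_rank _ tM) => <- <- /addIn.
Qed.

Variable t : 'I_n -> nat.
Local Notation slot := (slot t).

Section Generated.
Variables (M : fdmod A) (z : slot -> M).
Hypothesis ez : forall s, act M (e (tag s)) (z s) = z s.
Hypothesis zgen : forall x, exists a : slot -> A, x = \sum_s act M (a s) (z s).

Lemma rad_gen x : x \in (rad M : {vspace M}) ->
  exists2 b : slot -> A, (forall s, b s \in jacobson A) &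
    x = \sum_s act M (b s) (z s).
Proof.
move=> xr; have /memv_sumP[y yP ->] :
    x \in (\sum_s (eval_at (z s) @: jacobson A))%VS.
  apply: subvP xr; apply/actv_subP => a y aJ _; have [c ->] := zgen y.
  rewrite linear_sum; apply: memv_sumr => s _ /=.
  by rewrite -actMx -eval_atE memv_img // jacobsonMr.
have /choice[b bP] : forall s, exists b, b \in jacobson A /\ y s = act M b (z s).
  by move=> s; have /memv_imgP[b bJ ->] := yP s isT; exists b; rewrite eval_atE.
exists b => [s|]; first by have [] := bP s.
by apply: eq_bigr => s _; have [] := bP s.
Qed.

(** If the top of M is the direct sum of the S_i, one for each slot (i, j), then
    the generators are independent over A / J modulo the radical. *)
Lemma gen_indep : iso (top M) (cyclic_sum e (fun i (_ : 'I_(t i)) => Je (e i))) ->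
  forall a : slot -> A, \sum_s act M (a s) (z s) \in (rad M : {vspace M}) ->
  forall s, a s * e (tag s) \in jacobson A.
Proof.
move=> hT a; pose q := quot_proj (rad M).
have qsum b : q (\sum_s act M (b s) (z s)) = \sum_s act (top M) (b s) (q (z s)).
  by rewrite linear_sum; apply: eq_bigr => s _; rewrite -quot_hom.
have [] := @presents_dim _ _ _ e t ee (fun i _ => Je (e i)) (top M) (fun s => q (z s)).
- by move=> s; rewrite -quot_hom ez.
- move=> s c /mem_Je-/(_ (ee _)) [cJ _] _; rewrite -quot_hom; apply/eqP.
  by rewrite quot_proj_eq0 memv_rad.
- by move=> y; have [x ->] := quot_surj y; have [b ->] := zgen x; exists b; rewrite -qsum.
- exact: iso_dim hT.
move=> _ _ zJ; rewrite -quot_proj_eq0 -/q qsum => /eqP /zJ h s.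
by have /mem_Je-/(_ (ee _)) [] := h s.
Qed.

End Generated.

End HomogeneousParts.

Section Rigid.
Variables (K : closedFieldType) (A : falgType K) (n : nat) (e : 'I_n -> A).
Hypotheses (he : full_primitive_idempotents e) (hA : basic e).
Variables (M : fdmod A) (t : 'I_n -> nat).
Local Notation slot := (slot t).
Hypothesis hT : iso (top M) (cyclic_sum e (fun i (_ : 'I_(t i)) => Je (e i))).
Variable C : forall i : 'I_n, 'I_(t i) -> left_ideal A.
Hypothesis M_C : iso M (cyclic_sum e C).
Hypothesis C_Ae : forall (i : 'I_n) (j : 'I_(t i)), (C j <= Ae (e i))%VS.
Hypothesis C_chain : forall (i : 'I_n) (j j' : 'I_(t i)),
  (C j <= C j')%VS \/ (C j' <= C j)%VS.
Hypothesis C_hom : forall (i k : 'I_n)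
    (f : 'Hom(submodule (Ae (e i)), submodule (Je (e k)))), is_hom f ->
  forall (j : 'I_(t i)) (l : 'I_(t k)) (x : submodule (Ae (e i))),
    vsval x \in sub_space (C j) -> vsval (f x) \in sub_space (C l).

Local Notation J := (jacobson A).
Local Notation Cs s := (C (tagged s) : {vspace A}).

Let ee i : idempotent_elt (e i).
Proof. by case: he => /(_ i)[]. Qed.

Let e_neq0 i : e i <> 0.
Proof. by case: he => /(_ i)[]. Qed.

Let e_ortho i j : i != j -> e i * e j = 0.
Proof. by case: he => _ h _; apply: h. Qed.

(** The condition on homomorphisms in terms of elements: a homomorphism from A e_i
    to J e_k is the multiplication on the right by an element of e_i J e_k. *)
Lemma C_mulr (s s' : slot) c u : c \in Cs s -> u \in J ->
  e (tag s) * u = u -> u * e (tag s') = u -> c * u \in Cs s'.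
Proof.
move=> cC uJ eu ue.
pose f : 'Hom(submodule (Ae (e (tag s))), submodule (Je (e (tag s')))) :=
  (linfun (vsproj (Je (e (tag s')))) \o amulr u
     \o linfun (@vsval _ _ (Ae (e (tag s)))))%VF.
have fE x : vsval (f x) = vsval x * u.
  rewrite !comp_lfunE !lfunE /= vsprojK //; apply/mem_Je => //.
  by rewrite -mulrA ue; split=> //; apply: jacobsonMl.
have fh : is_hom f.
  by move=> a x; apply: subvs_inj; rewrite fE !sub_actE fE !regularE mulrA.
have cA := subvP (C_Ae (tagged s)) _ cC.
have := @C_hom _ _ f fh (tagged s) (tagged s') (vsproj (Ae (e (tag s))) c).
by rewrite fE vsprojK //; apply.
Qed.

(** Elements defining the space of all x in e_i M with C_ij x = 0. *)
Definition slot_cond (s : slot) : seq A := rcons (vbasis (Cs s)) (1 - e (tag s)).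

Lemma mem_slot_cond (N : fdmod A) s (x : N) : x \in killed N (slot_cond s) <->
  act N (e (tag s)) x = x /\ forall c, c \in Cs s -> act N c x = 0.
Proof.
split=> [/mem_killed h|[ex cx]].
  split.
    have := h (1 - e (tag s)); rewrite mem_rcons mem_head actBl act1x.
    by move/(_ isT)/eqP; rewrite subr_eq0 => /eqP.
  move=> c cC; rewrite (coord_vbasis cC) act_suml big1 // => i _.
  by rewrite actZl h ?scaler0 // mem_rcons inE mem_nth ?orbT // size_tuple.
apply/mem_killed => c; rewrite mem_rcons inE => /predU1P[->|/vbasis_mem /cx //].
by rewrite actBl act1x ex subrr.
Qed.

(** The slots with the same idempotent as s and a larger annihilator. *)
Definition above (s : slot) : pred slot :=
  fun s' => (tag s' == tag s) && (Cs s <= Cs s')%VS.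

Section Presented.
Variable z : slot -> M.
Hypothesis zC : presents e C z.

(** An element of e_i rad M is a sum of terms u z_s with u in e_i J e_s; such a u
    multiplies C_ij into C_s, so C_ij kills it. *)
Lemma killed_eradpart s (x : M) :
  x \in eradpart e M (tag s) -> x \in killed M (slot_cond s).
Proof.
case: (zC) => ez zgen _; rewrite memv_cap => /andP[/(mem_epart ee) ex].
case/(rad_gen zgen) => b bJ xE; apply/mem_slot_cond; split=> // c cC.
rewrite -ex xE linear_sum linear_sum big1 // => s' _ /=.
rewrite -{1}ez -!actMx; apply: (presents_kill zC).
  rewrite -!mulrA; apply: (C_mulr cC).
  - by apply: jacobsonMl; apply: jacobsonMr.
  - by rewrite !mulrA ee.
  - by rewrite -!mulrA ee.
by rewrite -!mulrA ee.
Qed.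

Lemma gen_indep_scalar (k : slot -> K) :
  \sum_s k s *: z s \in (rad M : {vspace M}) -> forall s, k s = 0.
Proof.
case: (zC) => ez zgen _ kr s.
have kJ : k s *: e (tag s) \in J.
  have := gen_indep ee ez zgen hT (a := fun s => (k s)%:A) _ s.
  rewrite mulr_algl; apply.
  by rewrite (eq_bigr (fun s => k s *: z s)) // => s' _; rewrite actZl act1x.
apply/eqP; apply: contraT => ks; case: (e_neq0 (i := tag s)).
apply: idempotent_notin_jacobson => //.
by rewrite -[e _]scale1r -(mulVf ks) -scalerA memvZ.
Qed.

(** The space of all x in e_i M with C_ij x = 0 contains e_i rad M and the
    generators of the slots above (i, j). *)
Lemma dim_killed_geq s : (\dim (eradpart e M (tag s)) + #|above s| <=
  \dim (killed M (slot_cond s)))%N.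
Proof.
case: (zC) => ez zgen _; pose q := quot_proj (rad M).
rewrite -(limg_ker_dim q (killed M (slot_cond s))); apply: leq_add.
  apply: dimvS; apply/subvP => x xr; rewrite memv_cap killed_eradpart //.
  by move: xr; rewrite memv_cap memv_ker quot_proj_eq0 => /andP[].
rewrite -(@dim_sum_line _ _ _ (fun s => q (z s)) (above s)); last first.
  move=> k kq; apply: gen_indep_scalar; rewrite -quot_proj_eq0 -/q linear_sum.
  by apply/eqP; rewrite -[RHS]kq; apply: eq_bigr => s' _; rewrite linearZ.
apply: dimvS; apply/subv_sumP => s' /andP[/eqP tss' CC].
apply: memv_img; apply/mem_slot_cond; split=> [|c cC]; first by rewrite -tss' ez.
apply: (presents_kill zC); first exact: (subvP CC).
by rewrite tss'; apply/mem_Ae => //; apply: (subvP (C_Ae (tagged s))).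
Qed.

(** Over an algebraically closed field, e_i M is spanned modulo the radical by the
    generators with idempotent e_i, as e_i A e_i is K e_i plus radical elements
    and e_i A e_k is radical for k distinct from i. *)
Lemma dim_epart_leq i : (\dim (epart e M i) <=
  \dim (eradpart e M i) + #|[pred s : slot | tag s == i]|)%N.
Proof.
case: (zC) => ez zgen _.
apply: (@leq_trans (\dim (eradpart e M i +
    \sum_(s : slot | tag s == i) <[z s]>)%VS)); last first.
  apply: leq_trans (dimv_add_leqif _ _) _; rewrite leq_add2l.
  exact: dim_sum_line_leq.
apply: dimvS; apply/subvP => x /(mem_epart ee) <-; have [a ->] := zgen x.
rewrite linear_sum; apply: memv_suml => s _ /=.
rewrite -ez -!actMx; set w := _ * _.
have ew : e i * w = w by rewrite /w !mulrA ee.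
have we : w * e (tag s) = w by rewrite /w -!mulrA ee.
have in_rad u : u \in J -> e i * u = u ->
    act M u (z s) \in (eradpart e M i + \sum_(s : slot | tag s == i) <[z s]>)%VS.
  move=> uJ eu; apply: (subvP (addvSl _ _)); rewrite memv_cap memv_rad // andbT.
  by apply/(mem_epart ee); rewrite -actMx eu.
have [si|nsi] := eqVneq i (tag s); last first.
  by apply: in_rad => //; apply: (basic_offdiag he hA nsi).
have [k kJ] : exists k, w - k *: e i \in J.
  by case: he => ep _ _; apply: (primitive_residue (ep i)); rewrite // si.
rewrite -[w](subrK (k *: e i)) actDl; apply: memvD.
  by apply: in_rad => //; rewrite mulrBr ew -scalerAr ee.
rewrite actZl; apply: memvZ; apply: (subvP (addvSr _ _)).
rewrite {1}si ez; apply: (subvP (sumv_sup s _ (subvv _))); first by rewrite si.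
exact: memv_line.
Qed.

End Presented.

Section Degeneration.
Variable M' : fdmod A.
Hypothesis deg : degeneration e M M'.
Hypothesis topM' : iso (top M') (top M).

Lemma eradpart_degeneration i : \dim (eradpart e M' i) = \dim (eradpart e M i).
Proof. by apply: dim_eradpart_eq => //; apply: degeneration_rank. Qed.

(** Generators of M' are picked one at a time, starting with those that have the
    largest annihilators: the number of slots above s exceeds the number of
    generators picked so far. The set B of the slots already treated is closed
    under passing to larger annihilators. *)
Lemma pick_generators i m : (m <= #|[pred s : slot | tag s == i]|)%N ->
  exists (B : {set slot}) (z : slot -> M'),
  [/\ #|B| = m, forall s, s \in B -> tag s = i,
      forall s s', s \in B -> tag s' = i -> (\dim (Cs s) < \dim (Cs s'))%N -> s' \in B,
      forall s, s \in B -> z s \in killed M' (slot_cond s) &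
      \dim (eradpart e M' i + \sum_(s in B) <[z s]>)%VS =
        (\dim (eradpart e M' i) + m)%N].
Proof.
elim: m => [_|m IH mlt].
  exists set0, (fun=> 0); split; first by rewrite cards0.
  - by move=> s; rewrite inE.
  - by move=> s s'; rewrite inE.
  - by move=> s; rewrite inE.
  by rewrite big_set0 addv0 addn0.
have [B [z [cB Bi Bup Bk Bd]]] := IH (ltnW mlt).
have [s0 /andP[s0i s0B]] : exists s, (tag s == i) && (s \notin B).
  apply/existsP; apply: contraLR mlt; rewrite negb_exists => /forallP h.
  rewrite -leqNgt -cB; apply: subset_leq_card; apply/subsetP => s /[!inE] si.
  by have := h s; rewrite si negbK.
have [s /andP[/eqP si sB] smax] := @arg_maxnP _ s0
  (fun s : slot => (tag s == i) && (s \notin B)) (fun s => \dim (Cs s))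
  (introT andP (conj s0i s0B)).
(* All slots of B, and s itself, are above s. *)
have mabove : (m < #|above s|)%N.
  have sa : s \in above s by rewrite unfold_in /above eqxx subvv.
  rewrite -cB (cardD1 s (above s)) sa ltnS.
  apply: subset_leq_card; apply/subsetP => s' s'B; rewrite !inE.
  have s's : s' != s by apply: contraNneq sB => <-.
  have tt : tag s' = tag s by rewrite (Bi _ s'B) si.
  rewrite s's unfold_in /above /=.
  have dC : (\dim (Cs s) <= \dim (Cs s'))%N.
    rewrite leqNgt; apply/negP => lt; case/negP: sB; exact: (Bup s').
  case: s' tt {s'B s's} dC => i' j' /= tt; move: j'; rewrite tt => j' dC.
  rewrite eqxx /=; have [|CC] // := C_chain (tagged s) j'.
  by have /eqP <- : (C j' : {vspace A}) == C (tagged s) by rewrite eqEdim CC.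
have [x xk xB] : exists2 x, x \in killed M' (slot_cond s) &
    x \notin (eradpart e M' i + \sum_(s in B) <[z s]>)%VS.
  have /subvPn[x xk xB] : ~~ (killed M' (slot_cond s) <=
      eradpart e M' i + \sum_(s in B) <[z s]>)%VS; last by exists x.
  apply: contraL mabove => /dimvS; rewrite Bd => le; rewrite -leqNgt.
  have := leq_trans (degeneration_killed (slot_cond s) deg) le.
  have [z0 z0C] := (presents_iso ee _ _).2 M_C.
  by move/(leq_trans (dim_killed_geq z0C s)); rewrite si eradpart_degeneration leq_add2l.
pose z' s' := if s' == s then x else z s'.
have z'B s' : s' \in B -> z' s' = z s'.
  by rewrite /z'; case: eqP => // -> sB'; rewrite sB' in sB.
exists (s |: B), z'; split.
- by rewrite cardsU1 sB cB.
- by move=> s' /setU1P[->|/Bi].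
- move=> s1 s2 /setU1P[->|s1B] s2i lt; rewrite in_setU1; last by rewrite (Bup s1) ?orbT.
  apply/orP; right; apply: contraLR lt => s2B; rewrite -leqNgt.
  by apply: smax; rewrite s2i eqxx.
- by move=> s' /setU1P[->|s'B]; [rewrite /z' eqxx | rewrite z'B // Bk].
have z's : z' s = x by rewrite /z' eqxx.
rewrite big_setU1 //= z's.
rewrite (eq_bigr (fun s => <[z s]>%VS)) => [|s' s'B]; last by rewrite z'B.
rewrite addvA [(eradpart _ _ _ + _)%VS]addvC -addvA dimv_disjoint_sum.
  have x0 : x != 0 by apply: contraNneq xB => ->; rewrite mem0v.
  by rewrite Bd dim_vline x0 addnS.
apply/eqP; rewrite -subv0; apply/subvP => y; rewrite memv_cap.
case/andP=> /vlineP[k ->] kx; rewrite memv0 scaler_eq0.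
case: eqP => //= /eqP k0; case/negP: xB.
by rewrite -[x]scale1r -(mulVf k0) -scalerA memvZ.
Qed.

(** The generators picked in the parts e_i M' generate M' by Nakayama's lemma, and
    satisfy the relations of the generators of M. *)
Lemma rigid_iso : iso M' M.
Proof.
have dimM : \dim {:M'} = \dim {:M}.
  case: deg => rho [rho' [_ [f [/bij_dim fd _]] _ [f' [/bij_dim fd' _]] _]].
  by rewrite -fd -fd'.
apply: iso_trans (iso_sym M_C).
have [z0 z0C] := (presents_iso ee _ _).2 M_C.
have /choice[z zP] : forall i, exists z : slot -> M',
    (forall s, tag s = i -> z s \in killed M' (slot_cond s)) /\
    (epart e M' i <= eradpart e M' i + \sum_(s | tag s == i) <[z s]>)%VS.
  move=> i; have [B [z [cB Bi _ Bk Bd]]] := @pick_generators i _ (leqnn _).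
  have BE s : (s \in B) = (tag s == i).
    have sub : B \subset [pred s : slot | tag s == i].
      by apply/subsetP => s' /Bi <-; rewrite inE.
    by have /subset_cardP/(_ sub) -> := cB; rewrite inE.
  exists z; split=> [s si|]; first by rewrite Bk // BE si.
  rewrite (eq_bigl _ _ BE) in Bd.
  suff /eqP <- : (eradpart e M' i + \sum_(s | tag s == i) <[z s]>)%VS == epart e M' i by [].
  rewrite eqEdim Bd subv_add capvSl /=; apply/andP; split.
    apply/subv_sumP => s /eqP si; rewrite -memvE.
    have /mem_slot_cond[ez _] : z s \in killed M' (slot_cond s) by rewrite Bk // BE si.
    by apply/(mem_epart ee); rewrite -si.
  rewrite eradpart_degeneration (degeneration_rank _ deg).
  exact: dim_epart_leq z0C i.
pose z' s := z (tag s) s.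
have zk s : z' s \in killed M' (slot_cond s) by have [h _] := zP (tag s); apply: h.
have gen_st (a : A) (x : M') : x \in (\sum_s limg (eval_at (z' s)))%VS ->
    act M' a x \in (\sum_s limg (eval_at (z' s)))%VS.
  case/memv_sumP=> y yP ->; rewrite linear_sum; apply: memv_sumr => s _ /=.
  have /memv_imgP[b _ ->] := yP s isT.
  by rewrite eval_atE -actMx -eval_atE memv_img ?memvf.
have full : (submod_of gen_st : {vspace M'}) = fullv.
  apply: nakayama; apply/vspaceP => x; rewrite memvf -[x]act1x.
  case: he => _ _ <-; rewrite act_suml; apply: memv_suml => i _.
  have : act M' (e i) x \in epart e M' i by rewrite memv_img ?memvf.
  have [_ h] := zP i; move/(subvP h); apply: subvP.
  rewrite addvC; apply: addvS; last exact: capvSr.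
  apply/subv_sumP => s /eqP si; apply: (sumv_sup s) => //.
  rewrite -memvE /z' si; have := memv_img (eval_at (z i s)) (memvf 1).
  by rewrite eval_atE act1x.
apply/(presents_iso ee); exists z'; apply: (presents_dim ee).
- by move=> s; have /mem_slot_cond[] := zk s.
- by move=> s c cC _; have /mem_slot_cond[_ h] := zk s; apply: h.
- move=> x; have := memvf x; rewrite -full => /memv_sumP[y yP ->].
  have /choice[a aE] : forall s, exists a, y s = act M' a (z' s).
    by move=> s; have /memv_imgP[b _ ->] := yP s isT; exists b; rewrite eval_atE.
  by exists a; apply: eq_bigr => s _.
by rewrite dimM; apply: iso_dim.
Qed.

End Degeneration.

End Rigid.

(** * Rational curves in the module variety *)

Section Curves.
Import passmx.
Variable K : closedFieldType.

Section Clear.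
Variable delta : {poly K}.

(** Functions that become polynomial after multiplication by a power of
    delta. *)
Let clears (g : K -> K) := exists (Q : {poly K}) (m : nat),
  forall s, delta.[s] != 0 -> Q.[s] = delta.[s] ^+ m * g s.

Let clears_cst c : clears (fun=> c).
Proof. by exists c%:P, 0%N => s _; rewrite hornerC mul1r. Qed.

Let clearsD g h : clears g -> clears h -> clears (fun s => g s + h s).
Proof.
move=> [Q [m QE]] [R [k RE]].
exists (delta ^+ k * Q + delta ^+ m * R), (k + m)%N => s ds.
rewrite hornerD !hornerM !horner_exp QE // RE // exprD mulrDr -!mulrA.
by rewrite [X in _ = _ + X]mulrCA.
Qed.

Let clearsM g h : clears g -> clears h -> clears (fun s => g s * h s).
Proof.
move=> [Q [m QE]] [R [k RE]]; exists (Q * R), (m + k)%N => s ds.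
by rewrite hornerM QE // RE // exprD mulrACA.
Qed.

Let clears_sum (I : Type) (r : seq I) (F : I -> K -> K) :
  (forall i, clears (F i)) -> clears (fun s => \sum_(i <- r) F i s).
Proof.
move=> cF; elim: r => [|i r [Q [m QE]]].
  by exists 0, 0%N => s _; rewrite big_nil horner0 mulr0.
have [R [k RE]] := clearsD (cF i) (ex_intro _ Q (ex_intro _ m QE)).
by exists R, k => s ds; rewrite RE // big_cons.
Qed.

Let clears_prod (I : Type) (r : seq I) (F : I -> K -> K) :
  (forall i, clears (F i)) -> clears (fun s => \prod_(i <- r) F i s).
Proof.
move=> cF; elim: r => [|i r [Q [m QE]]].
  by exists 1, 0%N => s _; rewrite big_nil hornerC mulr1.
have [R [k RE]] := clearsM (cF i) (ex_intro _ Q (ex_intro _ m QE)).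
by exists R, k => s ds; rewrite RE // big_cons.
Qed.

Let clearsX g k : clears g -> clears (fun s => g s ^+ k).
Proof.
move=> cg; have [Q [m QE]] := clears_prod (index_iota 0 k) (fun _ : nat => cg).
by exists Q, m => s ds; rewrite QE // prodr_const_nat subn0.
Qed.

(** If a rational curve g = r / delta is defined at 0 and lies in S for all but
    finitely many values of the parameter, then its value at 0 lies in the
    closure of S. *)
Lemma zariski_curve (V : vectType K) (S : V -> Prop) (g r : K -> V)
    (theta : {poly K}) :
  delta.[0] != 0 -> theta != 0 ->
  (forall s, delta.[s] != 0 -> g s = (delta.[s])^-1 *: r s) ->
  (forall k, exists c : {poly K}, forall s, affine_coord (r s) k = c.[s]) ->
  (forall s, delta.[s] != 0 -> theta.[s] != 0 -> S (g s)) ->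
  zariski_closure S (g 0).
Proof.
move=> d0 t0 gE rP Sg p pS.
have ccoord k : clears (fun s => affine_coord (g s) k).
  have [c cE] := rP k; exists c, 1%N => s ds.
  by rewrite -cE gE // /affine_coord linearZ /= expr1 mulrA divff // mul1r.
have [Q [m QE]] : clears (fun s => p.@[affine_coord (g s)]).
  have [|Q [m QE]] := @clears_sum _ (msupp p)
      (fun mm s => p@_mm * \prod_i affine_coord (g s) i ^+ mm i).
    by move=> mm; apply: clearsM => //; apply: clears_prod => i; apply: clearsX.
  by exists Q, m => s ds; rewrite QE // mevalE.
have /eqP : Q * (delta * theta) = 0.
  apply/eqP; apply/closed_nonrootP => -[s]; rewrite /root !hornerM !mulf_eq0.
  rewrite !negb_or => /and3P[Qs ds ts].
  by case/eqP: Qs; rewrite QE // pS ?mulr0 //; apply: Sg.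
have dn0 : delta != 0 by apply: contraNneq d0 => ->; rewrite horner0.
rewrite !mulf_eq0 (negPf dn0) (negPf t0) !orbF => /eqP Q0.
have /esym/eqP := QE 0 d0.
by rewrite Q0 horner0 mulf_eq0 expf_eq0 (negPf d0) andbF => /eqP.
Qed.

End Clear.

(** Up to the factor delta s, the inverse of 1 + s eta is polynomial in s. *)
Lemma one_plus_adjugate (V : vectType K) (eta : 'End(V)) :
  exists (delta : {poly K}) (m : nat) (theta : nat -> 'End(V)),
  delta.[0] = 1 /\ forall s, let T := (\1 + s *: eta)%VF in
    let U := \sum_(i < m) s ^+ i *: theta i in
    (U \o T)%VF = delta.[s] *: \1%VF /\ (T \o U)%VF = delta.[s] *: \1%VF.
Proof.
pose b := vbasis {:V}; pose H := mxof b b eta.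
have bB : basis_of {:V} b := vbasisP _; have bf := basis_free bB.
pose X : 'M[{poly K}]_(\dim {:V}) := 1%:M + 'X *: map_mx polyC H.
pose m := \max_i \max_j size (\adj X i j).
pose th i : 'End(V) := hommx b b (map_mx (coefp i) (\adj X)).
have XE s : map_mx (horner_eval s) X = mxof b b (\1 + s *: eta)%VF.
  rewrite linearD linearZ /= mxof1 //; apply/matrixP=> i j.
  by rewrite !mxE /horner_eval !hornerE; case: (i == j); rewrite !hornerE.
have thE s : \sum_(i < m) s ^+ i *: th i =
    hommx b b (map_mx (horner_eval s) (\adj X)).
  rewrite (eq_bigr (fun i : 'I_m => hommx b b (s ^+ i *: map_mx (coefp i) (\adj X)))).
    rewrite -linear_sum; congr (hommx b b _); apply/matrixP=> i j.
    rewrite summxE !mxE /horner_eval (@horner_coef_wide _ m).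
      by apply: eq_bigr => k _; rewrite !mxE mulrC.
    by apply: (bigmax_sup i) => //; apply: (bigmax_sup j) => //; rewrite mxE.
  by move=> i _; rewrite linearZ.
exists (\det X), m, th; split.
  rewrite -[_.[0]]/(horner_eval 0 _) -det_map_mx XE scale0r addr0 mxof1 //.
  exact: det1.
move=> s T U; rewrite /U thE -[T](mxofK bB bB) -XE.
have hs (a : K) : hommx b b a%:M = a *: \1%VF.
  by rewrite -[a]mulr1 -scale_scalar_mx linearZ /= (hommx1 bB) mulr1.
rewrite -!hommx_mul //; split.
  by rewrite -map_mxM mul_mx_adj map_scalar_mx hs.
by rewrite -map_mxM mul_adj_mx map_scalar_mx hs.
Qed.

(** v + s is injective for all but finitely many s. *)
Lemma shift_injective (V : vectType K) (v : 'End(V)) :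
  exists2 theta : {poly K}, theta != 0 &
    forall s, theta.[s] != 0 -> forall x, v x + s *: x = 0 -> x = 0.
Proof.
pose b := vbasis {:V}; have bB := vbasisP {:V}.
exists (char_poly (- mxof b b v)); first exact/monic_neq0/char_poly_monic.
move=> s; rewrite -/(root _ s) -eigenvalue_root_char => /eigenvalueP no x vx.
apply/eqP; apply: contraT => x0; case: no; exists (rVof b x); last first.
  by rewrite (rVof_eq0 bB).
rewrite mulmxN mul_mxof rVofK ?vbasisP // -linearN -linearZ; congr (rVof b _).
by apply/eqP; rewrite -subr_eq0 -opprD vx oppr0.
Qed.

End Curves.

Section Coordinates.
Variables (K : fieldType) (A : falgType K) (n : nat) (e : 'I_n -> A).
Hypothesis ee : forall i, idempotent_elt (e i).
Hypothesis e_ortho : forall i j, i != j -> e i * e j = 0.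
Hypothesis e_sum : \sum_i e i = 1.

Section Adapted.
Variable Q : fdmod A.
Local Notation d := (dimension_vector e Q).
Local Notation N := (\sum_i d i)%N.

(** The vector of e_i Q with the coordinates of the i-th block of v. *)
Definition adapted_part (i : 'I_n) (v : 'cV[K]_N) : Q :=
  \sum_(j < d i) (submxcol v i : 'cV[K]_(d i)) j 0 *: (vbasis (epart e Q i))`_j.

Definition adapted_fun (v : 'cV[K]_N) : Q := \sum_i adapted_part i v.

Fact adapted_linear : linear adapted_fun.
Proof.
move=> k u v; rewrite /adapted_fun scaler_sumr -big_split; apply: eq_bigr => i _.
rewrite /adapted_part scaler_sumr -big_split; apply: eq_bigr => j _ /=.
by rewrite !mxE scalerA -scalerDl.
Qed.
HB.instance Definition _ := GRing.isLinear.Build K 'cV[K]_N Q _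
  adapted_fun adapted_linear.

(** Coordinates on Q adapted to its decomposition into the parts e_i Q. *)
Definition adapted : 'Hom('cV[K]_N, Q) := linfun adapted_fun.

Lemma act_adapted i v : act Q (e i) (adapted v) = adapted_part i v.
Proof.
have act_part k : act Q (e i) (adapted_part k v) =
    if k == i then adapted_part k v else 0.
  rewrite linear_sum /=; case: (eqVneq k i) => [->|ki].
    apply: eq_bigr => j _; rewrite linearZ /=; congr (_ *: _).
    by apply/(mem_epart ee); rewrite vbasis_mem // mem_nth // size_tuple.
  rewrite big1 // => j _; rewrite linearZ /=.
  have /(mem_epart ee) <- : (vbasis (epart e Q k))`_j \in epart e Q k.
    by rewrite vbasis_mem // mem_nth // size_tuple.
  by rewrite -actMx e_ortho 1?eq_sym // act0l scaler0.
rewrite lfunE /= /adapted_fun linear_sum (bigD1 i) //= act_part eqxx.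
by rewrite big1 ?addr0 // => k /negPf ki; rewrite act_part ki.
Qed.

Lemma adapted_proj i v :
  adapted (\mxdiag_j (((j == i)%:R)%:M : 'M[K]_(d j)) *m v) =
  act Q (e i) (adapted v).
Proof.
rewrite act_adapted lfunE /= /adapted_fun mxdiag_mulcv (bigD1 i) //=.
rewrite big1 ?addr0 => [|k /negPf ki].
  by apply: eq_bigr => j _; rewrite mxcolK eqxx mul1mx.
by rewrite /adapted_part mxcolK ki mul_scalar_mx scale0r big1 // => j _; rewrite mxE scale0r.
Qed.

Lemma adapted_bij : bijective adapted.
Proof.
apply: bij_lfun => [v v0|x].
  rewrite -[v]submxcolK -[RHS](@mxcol0 K n d 1); apply: eq_mxcol => i.
  have := act_adapted i v; rewrite v0 linear0 => /esym p0.
  have /freeP fr := basis_free (vbasisP (epart e Q i)).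
  by apply/colP=> j; rewrite [RHS]mxE; apply: (fr (fun j => (submxcol v i : 'cV[K]_(d i)) j 0)).
exists (\mxcol_i \col_(j < d i) coord (vbasis (epart e Q i)) j (act Q (e i) x)).
rewrite lfunE /= /adapted_fun -[x in LHS]act1x -e_sum act_suml.
apply: eq_bigr => i _; rewrite /adapted_part mxcolK.
have xi : act Q (e i) x \in epart e Q i by rewrite memv_img ?memvf.
by rewrite [LHS](coord_vbasis xi); apply: eq_bigr => j _; rewrite mxE.
Qed.

End Adapted.

(** Transport of a module structure along coordinates. *)
Lemma mod_variety_transport (d : 'I_n -> nat) (M : fdmod A)
    (f : 'Hom('cV[K]_(\sum_i d i)%N, M))
    (rho : 'Hom(A, 'M[K]_(\sum_i d i)%N)) : bijective f ->
  (forall i v, f (\mxdiag_j (((j == i)%:R)%:M : 'M[K]_(d j)) *m v) =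
    act M (e i) (f v)) ->
  (forall a v, f (rho a *m v) = act M a (f v)) ->
  mod_variety e rho /\ represents rho M.
Proof.
move=> fb fe frho; have finj := bij_inj fb; split; last by exists f.
split.
- by apply: mulmx_ext => v; apply: finj; rewrite frho act1x mul1mx.
- move=> a b; apply: mulmx_ext => v; apply: finj.
  by rewrite -mulmxA !frho actMx.
by move=> i; apply: mulmx_ext => v; apply: finj; rewrite frho fe.
Qed.

(** A matrix commuting with the block projections is block diagonal. *)
Lemma mxdiag_commute (d : 'I_n -> nat) (G : 'M[K]_(\sum_i d i)%N) :
  (forall i, \mxdiag_j (((j == i)%:R)%:M : 'M[K]_(d j)) *m G =
    G *m \mxdiag_j (((j == i)%:R)%:M : 'M[K]_(d j))) ->
  G = \mxdiag_i submxblock G i i.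
Proof.
move=> comm; rewrite -{1}[G]submxblockK /mxdiag; apply: eq_mxblock => i j.
case: (eqVneq i j) => [->|ij]; first by rewrite conform_mx_id.
have := comm i; rewrite -{1 2}[G]submxblockK mul_mxdiag_mxblock mul_mxblock_mxdiag.
move/eq_mxblockP/(_ i j); rewrite eqxx mul1mx => ->.
by rewrite eq_sym (negPf ij) mul_mx_scalar scale0r.
Qed.

(** Two points representing the same module lie in the same orbit. *)
Lemma represents_GL_orbit (d : 'I_n -> nat) (M : fdmod A)
    (rho sigma : 'Hom(A, 'M[K]_(\sum_i d i)%N)) :
  mod_variety e rho -> represents rho M ->
  mod_variety e sigma -> represents sigma M -> GL_orbit rho sigma.
Proof.
move=> [_ _ rhoE] [f [fb frho]] [_ _ sigmaE] [f' [fb' fsigma]].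
have [fK fVK] := lfun_inv fb; have [fK' fVK'] := lfun_inv fb'.
pose mat (h : 'End('cV[K]_(\sum_i d i)%N)) : 'M[K]_(\sum_i d i)%N :=
  \matrix_(k, l) h (delta_mx l 0) k 0.
have matE h v : mat h *m v = h v.
  rewrite [in RHS](matrix_sum_delta v) linear_sum; apply/colP => k.
  rewrite mxE summxE; apply: eq_bigr => l _.
  by rewrite big_ord1 linearZ !mxE /= mulrC ord1.
pose G := mat (f'^-1 \o f)%VF; pose H := mat (f^-1 \o f')%VF.
have GE v : f' (G *m v) = f v by rewrite matE comp_lfunE fVK'.
have HE v : f (H *m v) = f' v by rewrite matE comp_lfunE fVK.
have finj := bij_inj fb; have finj' := bij_inj fb'.
(* G is the change of coordinates from f to f', and H its inverse. *)
have GH : G *m H = 1%:M.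
  by apply: mulmx_ext => v; apply: finj'; rewrite -mulmxA GE HE mul1mx.
have Gr a : G *m rho a = sigma a *m G.
  by apply: mulmx_ext => v; apply: finj'; rewrite -!mulmxA GE frho fsigma GE.
have Hr a : H *m sigma a = rho a *m H.
  by apply: mulmx_ext => v; apply: finj; rewrite -!mulmxA HE frho fsigma HE.
have Gd : G = \mxdiag_i submxblock G i i.
  by apply: mxdiag_commute => i; rewrite -{1}sigmaE -Gr rhoE.
have Hd : H = \mxdiag_i submxblock H i i.
  by apply: mxdiag_commute => i; rewrite -{1}rhoE -Hr sigmaE.
have /mulmx1_unit[Gu _] := GH.
exists (fun i => submxblock G i i); split=> [i|a]; last first.
  by rewrite -Gd Gr mulmxK.
move: GH; rewrite {1}Gd {1}Hd mxdiag_mul -(mxdiagZ 1) => /eq_mxdiagP/(_ i).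
by case/mulmx1_unit.
Qed.

End Coordinates.

(** * Degenerations of quotients *)

Section QuotientCurve.
Variables (K : closedFieldType) (A : falgType K) (n : nat) (e : 'I_n -> A).
Hypothesis ee : forall i, idempotent_elt (e i).
Hypothesis e_ortho : forall i j, i != j -> e i * e j = 0.
Hypothesis e_sum : \sum_i e i = 1.

Variables (P : fdmod A) (C' : submod P) (eta : 'End(P)).
Hypothesis eta_e : forall i x, eta (act P (e i) x) = act P (e i) (eta x).

Local Notation Q := (quotient C').
Local Notation d := (dimension_vector e Q).
Local Notation N := (\sum_i d i)%N.
Let q := quot_proj C'.
Let Phi := adapted e Q.

Let Phi_bij : bijective Phi.
Proof. exact: adapted_bij. Qed.

Let lift : 'Hom('cV[K]_N, P) := (linfun (@vsval _ _ (C'^C)%VS) \o Phi)%VF.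

Let liftE v : lift v = vsval (Phi v).
Proof. by rewrite comp_lfunE lfunE. Qed.

Definition curve_fun (U T : 'End(P)) (a : A) : 'M[K]_N :=
  \matrix_(k, l) ((Phi^-1 \o q \o U \o act P a \o T \o lift)%VF (delta_mx l 0) k 0).

Fact curve_linear U T : linear (curve_fun U T).
Proof.
move=> k a b; apply/matrixP=> i j; rewrite !mxE !comp_lfunE actDl actZl.
by rewrite !linearP !mxE.
Qed.
HB.instance Definition _ U T := GRing.isLinear.Build K A 'M[K]_N _
  (curve_fun U T) (curve_linear U T).

(** In the coordinates of P / C', the operator U a T. *)
Definition curve U T : 'Hom(A, 'M[K]_N) := linfun (curve_fun U T).

Lemma curveE U T a v : Phi (curve U T a *m v) = q (U (act P a (T (lift v)))).
Proof.
have [_ PhiVK] := lfun_inv Phi_bij.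
have -> : curve U T a *m v =
    (Phi^-1 \o q \o U \o act P a \o T \o lift)%VF v.
  rewrite [in RHS](matrix_sum_delta v) linear_sum; apply/colP => k.
  rewrite mxE summxE; apply: eq_bigr => l _.
  by rewrite big_ord1 linearZ lfunE !mxE /= mulrC ord1.
by rewrite !comp_lfunE PhiVK.
Qed.

Lemma curve_inj (rho sigma : 'Hom(A, 'M[K]_N)) :
  (forall a v, Phi (rho a *m v) = Phi (sigma a *m v)) -> rho = sigma.
Proof.
move=> h; apply/lfunP => a; apply: mulmx_ext => v.
exact: (bij_inj Phi_bij).
Qed.

Lemma curve_sum (m : nat) (U : nat -> 'End(P)) (s : K) :
  curve (\sum_(i < m) s ^+ i *: U i) (\1 + s *: eta)%VF =
  \sum_(i < m) s ^+ i *: (curve (U i) \1 + s *: curve (U i) eta).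
Proof.
apply: curve_inj => a v; rewrite curveE !sum_lfunE linear_sum.
rewrite mulmx_suml linear_sum; apply: eq_bigr => i _ /=.
rewrite !scale_lfunE !add_lfunE !scale_lfunE -scalemxAl mulmxDl -scalemxAl.
rewrite [in RHS]linearZ /= [in RHS]linearD /= [in RHS]linearZ /= !curveE.
rewrite id_lfunE linearD linearD /= !linearZ /= linearD /= !linearZ /=.
by rewrite scalerDr.
Qed.

Variables (delta : {poly K}) (m : nat) (U : nat -> 'End(P)).
Local Notation T s := (\1 + s *: eta)%VF.
Local Notation V s := (\sum_(i < m) s ^+ i *: U i).
Hypothesis VT : forall s, (V s \o T s)%VF = delta.[s] *: \1%VF.
Hypothesis TV : forall s, (T s \o V s)%VF = delta.[s] *: \1%VF.

(** The inverse of 1 + s eta being V s / delta s, the action on P / C' obtained by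
    conjugating the action on P with 1 + s eta. *)
Definition rho_curve s := (delta.[s])^-1 *: curve (V s) (T s).

Let T_inj s : delta.[s] != 0 -> forall x, T s x = 0 -> x = 0.
Proof.
move=> ds x Tx; have := congr1 (fun f : 'End(P) => f x) (VT s).
rewrite comp_lfunE Tx linear0 scale_lfunE id_lfunE => /esym/eqP.
by rewrite scaler_eq0 (negPf ds) => /eqP.
Qed.

Lemma rho_curve_coord k : exists c : {poly K}, forall s,
  affine_coord (curve (V s) (T s)) k = c.[s].
Proof.
exists (\sum_(i < m) 'X^i * ((affine_coord (curve (U i) \1%VF) k)%:P +
  'X * (affine_coord (curve (U i) eta) k)%:P)) => s.
rewrite curve_sum /affine_coord linear_sum horner_sum; apply: eq_bigr => i _.
rewrite hornerM hornerXn hornerD hornerM hornerX !hornerC.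
by rewrite linearZ /= linearD /= linearZ.
Qed.

(** The point rho_curve s represents P / C_s, where C_s is the image of C' under
    1 + s eta. *)
Lemma rho_curve_represents s (Cs : submod P) : delta.[s] != 0 ->
  (T s @: C')%VS = (Cs : {vspace P}) ->
  mod_variety e (rho_curve s) /\ represents (rho_curve s) (quotient Cs).
Proof.
move=> ds TC; pose qs := quot_proj Cs.
have qsT x : (qs (T s x) == 0) = (x \in (C' : {vspace P})).
  rewrite quot_proj_eq0 -TC; apply/memv_imgP/idP => [[y yC Txy]|xC]; last by exists x.
  rewrite -(subrK y x) memvD //; suff -> : x - y = 0 by rewrite mem0v.
  by apply: (T_inj ds); rewrite linearB /= Txy subrr.
have qsTq x : qs (T s (vsval (q x))) = qs (T s x).
  by apply/eqP; rewrite -subr_eq0 -!linearB /= qsT quot_proj_valB.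
pose Psi : 'Hom('cV[K]_N, quotient Cs) := (qs \o T s \o lift)%VF.
have PsiE v : Psi v = qs (T s (vsval (Phi v))) by rewrite -liftE 2!comp_lfunE.
have Tsurj x : exists y, x = T s y.
  exists ((delta.[s])^-1 *: V s x); rewrite linearZ /= -[T s (V s x)]comp_lfunE TV.
  by rewrite scale_lfunE id_lfunE scalerA mulVf // scale1r.
have Psi_bij : bijective Psi.
  apply: bij_lfun => [v|y].
    rewrite PsiE => /eqP; rewrite qsT -quot_proj_eq0 quot_proj_val => /eqP Pv.
    by apply: (bij_inj Phi_bij); rewrite Pv linear0.
  have [x ->] := quot_surj y; have [x' ->] := Tsurj x.
  case: Phi_bij => g _ gK; exists (g (q x')).
  by rewrite PsiE gK qsTq.
apply: (mod_variety_transport Psi_bij) => [i v|a v]; rewrite !PsiE.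
  rewrite (adapted_proj ee e_ortho) -/Phi -{1}[Phi v]quot_proj_val -quot_hom qsTq.
  by rewrite !add_lfunE !scale_lfunE !id_lfunE eta_e -linearZ -linearD quot_hom.
have -> : Phi (rho_curve s a *m v) =
    q ((delta.[s])^-1 *: V s (act P a (T s (lift v)))).
  by rewrite /rho_curve scale_lfunE -scalemxAl linearZ /= curveE linearZ.
rewrite qsTq.
rewrite linearZ /= -[T s (V s _)]comp_lfunE TV scale_lfunE id_lfunE.
by rewrite scalerA mulVf // scale1r quot_hom liftE.
Qed.

End QuotientCurve.

Section CurveDegeneration.
Variables (K : closedFieldType) (A : falgType K) (n : nat) (e : 'I_n -> A).
Hypothesis ee : forall i, idempotent_elt (e i).
Hypothesis e_ortho : forall i j, i != j -> e i * e j = 0.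
Hypothesis e_sum : \sum_i e i = 1.

(** If eta commutes with the e_i and if, for almost all s, the image of C' under
    1 + s eta is a submodule with quotient M, then M degenerates to P / C'. *)
Lemma curve_degeneration (M P : fdmod A) (C' : submod P) (eta : 'End(P))
    (theta : {poly K}) :
  (forall i x, eta (act P (e i) x) = act P (e i) (eta x)) -> theta != 0 ->
  (forall s, theta.[s] != 0 -> (forall x, x + s *: eta x = 0 -> x = 0) ->
    exists2 Cs : submod P, iso (quotient Cs) M &
      ((\1 + s *: eta)%VF @: C')%VS = (Cs : {vspace P})) ->
  degeneration e M (quotient C').
Proof.
move=> eta_e t0 hC.
have [delta [m [U [d0 /all_and2[VT TV]]]]] := one_plus_adjugate eta.
have rep := rho_curve_represents ee e_ortho e_sum eta_e VT TV.
have dn0 : delta != 0.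
  by apply/eqP => z; move: d0; rewrite z horner0 => /esym/eqP; rewrite oner_eq0.
have good s : delta.[s] != 0 -> theta.[s] != 0 ->
    mod_variety e (rho_curve e C' eta delta m U s) /\
    represents (rho_curve e C' eta delta m U s) M.
  move=> ds ts; have [|Cs [f [fh fb]] TC] := hC s ts.
    move=> x Tx; have := congr1 (fun f : 'End(P) => f x) (VT s).
    rewrite comp_lfunE add_lfunE scale_lfunE !id_lfunE Tx linear0 scale_lfunE.
    by rewrite id_lfunE => /esym/eqP; rewrite scaler_eq0 (negPf ds) => /eqP.
  have [mv [g [gb grho]]] := rep C' s Cs ds TC; split=> //.
  exists (f \o g)%VF; split.
    by apply: (eq_bij (bij_comp fb gb)) => x; rewrite comp_lfunE.
  by move=> a v; rewrite !comp_lfunE grho fh.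
have [s0] : exists s0, ~~ root (delta * theta) s0.
  by apply/closed_nonrootP; rewrite mulf_neq0.
rewrite rootM negb_or => /andP[ds0 ts0]; have [mv0 rM0] := good _ ds0 ts0.
have [mvQ rQ] : mod_variety e (rho_curve e C' eta delta m U 0) /\
    represents (rho_curve e C' eta delta m U 0) (quotient C').
  by apply: rep; rewrite ?d0 ?oner_eq0 // scale0r addr0 lim1g.
have dE : dimension_vector e M = dimension_vector e (quotient C').
  apply/funext => i; rewrite /dimension_vector -(represents_rank (e i) rM0).
  rewrite -(represents_rank (e i) rQ); congr (\dim (limg _)); apply/lfunP => v.
  by case: mv0 mvQ => _ _ h0 [_ _ hQ]; rewrite !mat_endE h0 hQ.
rewrite /degeneration dE.
exists (rho_curve e C' eta delta m U s0), (rho_curve e C' eta delta m U 0).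
split=> //; apply: (@zariski_curve _ delta _ _ _ (fun s => curve e C'
    (\sum_(i < m) s ^+ i *: U i) (\1 + s *: eta)%VF) theta) => //.
- by rewrite d0 oner_eq0.
- exact: rho_curve_coord.
move=> s ds ts; have [mvs rMs] := good s ds ts.
exact: (represents_GL_orbit mv0 rM0 mvs rMs).
Qed.

End CurveDegeneration.

Section Move.
Variables (K : fieldType) (A : falgType K) (P : fdmod A) (v : 'End(P)).
Hypothesis vh : is_hom v.

(** The largest v-stable submodule of C. *)
Lemma stable_core (C : submod P) : exists D : submod P,
  forall x, x \in (D : {vspace P}) <->
    forall j, iter j v x \in (C : {vspace P}).
Proof.
have iter_lin j k x y : iter j v (k *: x + y) = k *: iter j v x + iter j v y.
  by elim: j => //= j ->; rewrite linearP.
have iter_act j a x : iter j v (act P a x) = act P a (iter j v x).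
  by elim: j => //= j ->; rewrite vh.
have [||U UE] := @vspace_of_pred _ _ (fun x => forall j, iter j v x \in (C : {vspace P})).
- by move=> j; elim: j => [|j IH] /=; rewrite ?mem0v // -iterS iterSr linear0.
- by move=> k x y xC yC j; rewrite iter_lin memvD ?memvZ.
have Ust a x : x \in U -> act P a x \in U.
  by move/UE => xC; apply/UE => j; rewrite iter_act submodP.
by exists (submod_of Ust).
Qed.

Variables C D : submod P.
Hypothesis DE : forall x, x \in (D : {vspace P}) <->
  forall j, iter j v x \in (C : {vspace P}).

Lemma core_sub : (D <= C)%VS.
Proof. by apply/subvP => x /DE/(_ 0%N). Qed.

Lemma core_stable x : x \in (D : {vspace P}) -> v x \in (D : {vspace P}).
Proof. by move/DE => h; apply/DE => j; rewrite -iterSr; apply: (h j.+1). Qed.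

Lemma core_back x : x \in (C : {vspace P}) -> v x \in (D : {vspace P}) ->
  x \in (D : {vspace P}).
Proof. by move=> xC /DE h; apply/DE => -[//|j]; rewrite iterSr. Qed.

Lemma limit_stable a x : x \in (v @: C + D)%VS -> act P a x \in (v @: C + D)%VS.
Proof.
case/memv_addP=> _ /memv_imgP[c cC ->] [d dD ->].
by rewrite linearD /= -vh memv_add ?memv_img ?submodP.
Qed.

(** The limit of (v + s) C as s tends to 0, for D the largest v-stable submodule
    of C. *)
Definition limit : submod P := submod_of limit_stable.

Lemma core_sub_limit : (D <= limit)%VS.
Proof. exact: addvSr. Qed.

Let q := quot_proj D.

Let capC (F : {vspace P}) :
  ((C :&: F) :&: lker (q \o v)%VF = D :&: F)%VS.
Proof.
apply/vspaceP => x; rewrite !memv_cap memv_ker comp_lfunE quot_proj_eq0.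
apply/idP/idP => [/andP[/andP[xC ->] vx]|/andP[xD ->]].
  by rewrite core_back.
by rewrite core_stable // (subvP core_sub).
Qed.

Let capL (G : {vspace P}) : ((limit :&: G) :&: lker q = D :&: G)%VS.
Proof.
apply/vspaceP => x; rewrite !memv_cap memv_ker quot_proj_eq0.
apply/idP/idP => [/andP[/andP[_ ->] ->] //|/andP[xD ->]].
by rewrite xD (subvP core_sub_limit).
Qed.

(** For F = G = P this is an equality; in general it compares the position of C
    and of its limit with respect to a filtration. *)
Lemma dim_limit_geq (F G : {vspace P}) : (v @: F <= G)%VS ->
  (\dim (C :&: F) + \dim (D :&: G) <= \dim (limit :&: G) + \dim (D :&: F))%N.
Proof.
move=> vFG; rewrite -(limg_ker_dim (q \o v)%VF (C :&: F)%VS) capC.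
rewrite -(limg_ker_dim q (limit :&: G)%VS) capL -addnA addnC leq_add2r.
rewrite addnC leq_add2l (limg_comp v q) dimvS // limgS //.
apply/subvP => _ /memv_imgP[x /memv_capP[xC xF] ->].
rewrite memv_cap (subvP vFG) ?memv_img // andbT.
by rewrite (subvP (addvSl _ _)) // memv_img.
Qed.

Lemma dim_limit : \dim limit = \dim C.
Proof.
have := limg_ker_dim (q \o v)%VF C; have := limg_ker_dim q limit.
have := capC fullv; have := capL fullv; rewrite !capvf => -> ->.
have -> : (q @: limit = (q \o v) @: C)%VS.
  rewrite (limg_comp v q); apply/eqP; rewrite eqEsubv andbC limgS ?addvSl //=.
  apply/subvP => _ /memv_imgP[_ /memv_addP[y yC [x xD ->]] ->].
  have /eqP qx : q x == 0 by rewrite quot_proj_eq0.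
  by rewrite linearD /= qx addr0 memv_img.
by move=> <- <-.
Qed.

End Move.

(** A bijective endomorphism of P carrying U onto U' induces an isomorphism of
    the quotients. *)
Lemma quotient_image (K : fieldType) (A : falgType K) (P : fdmod A)
    (u : 'End(P)) (U U' : submod P) : is_hom u ->
  (forall x, u x = 0 -> x = 0) -> (u @: U)%VS = (U' : {vspace P}) ->
  iso (quotient U) (quotient U').
Proof.
move=> uh uinj uU.
pose f : 'Hom(P, quotient U') := (quot_proj U' \o u)%VF.
have fE x : f x = quot_proj U' (u x) by rewrite /f (comp_lfunE (quot_proj U')).
apply: (@first_iso _ _ P (quotient U') f).
- by move=> a x; rewrite !fE uh quot_hom.
- have [g gK uK] := bij_lfun_dim uinj erefl.
  by move=> y; have [x ->] := quot_surj y; exists (g x); rewrite fE uK.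
move=> x; rewrite fE quot_proj_eq0 -uU.
apply/memv_imgP/idP => [[y yU uxy]|xU]; last by exists x.
suff -> : x = y by [].
by apply/eqP; rewrite -subr_eq0; apply/eqP/uinj; rewrite linearB /= uxy subrr.
Qed.

Section MoveDegeneration.
Variables (K : closedFieldType) (A : falgType K) (n : nat) (e : 'I_n -> A).
Hypothesis ee : forall i, idempotent_elt (e i).
Hypothesis e_ortho : forall i j, i != j -> e i * e j = 0.
Hypothesis e_sum : \sum_i e i = 1.

Variables (M P : fdmod A) (v : 'End(P)) (vh : is_hom v) (C D : submod P).
Hypothesis DE : forall x, x \in (D : {vspace P}) <->
  forall j, iter j v x \in (C : {vspace P}).

(** With eta sending v c to c modulo D and commuting with the e_i, the map
    1 + s eta carries the limit onto (v + s) C for almost all s. *)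
Lemma limit_degeneration :
  iso (quotient C) M -> degeneration e M (quotient (limit vh C D)).
Proof.
move=> CM; pose L := limit vh C D; pose q := quot_proj D.
(* eta maps v c to c, up to elements of D. *)
pose f := (q \o v \o projv C)%VF.
pose eta0 := (projv C \o f^-1 \o q)%VF.
have eta0_D x : x \in (D : {vspace P}) -> eta0 x = 0.
  move=> xD; have /eqP qx : q x == 0 by rewrite quot_proj_eq0.
  by rewrite 2!comp_lfunE qx !linear0.
have eta0_C x : eta0 x \in (C : {vspace P}) by rewrite 2!comp_lfunE memv_proj.
have eta0_v c : c \in (C : {vspace P}) -> v (eta0 (v c) - c) \in (D : {vspace P}).
  move=> cC; have fE y : f y = q (v (projv C y)) by rewrite 2!comp_lfunE.
  have fc : q (v c) = f c by rewrite fE projv_id.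
  have eta0E x : eta0 x = projv C (f^-1%VF (q x)) by rewrite 2!comp_lfunE.
  rewrite -quot_proj_eq0 -/q (linearB v) (linearB q) /= eta0E fc -fE.
  by rewrite limg_lfunVK ?subrr // memv_img ?memvf.
(* Averaging over the idempotents makes eta0 commute with them. *)
pose eta := (\sum_i (act P (e i) \o eta0 \o act P (e i)))%VF.
have etaE x : eta x = \sum_i act P (e i) (eta0 (act P (e i) x)).
  by rewrite sum_lfunE; apply: eq_bigr => i _; rewrite !comp_lfunE.
have eta_e i x : eta (act P (e i) x) = act P (e i) (eta x).
  rewrite !etaE [LHS](bigD1 i) //= -actMx ee big1 ?addr0 => [|k ki]; last first.
    by rewrite -actMx e_ortho // act0l !linear0.
  rewrite [RHS]linear_sum [RHS](bigD1 i) //= -actMx ee big1 ?addr0 // => k ki.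
  by rewrite -actMx e_ortho 1?eq_sym // act0l.
have [theta t0 tP] := shift_injective v.
apply: (curve_degeneration ee e_ortho e_sum (theta := theta) eta_e t0) => s ts Tinj.
(* Compare the images of the limit under 1 + s eta and of C under v + s. *)
pose u := (v + s *: \1)%VF.
have uE x : u x = v x + s *: x by rewrite add_lfunE scale_lfunE id_lfunE.
have uh : is_hom u by move=> a x; rewrite !uE vh linearD linearZ.
have uinj x : u x = 0 -> x = 0 by rewrite uE; apply: tP.
have u0 (U : {vspace P}) : \dim (u @: U) = \dim U.
  apply: limg_dim_eq; apply/eqP; rewrite -subv0; apply/subvP => x.
  by rewrite memv_cap memv_ker memv0 => /andP[_ /eqP/uinj ->].
have Cs_st a x : x \in (u @: C)%VS -> act P a x \in (u @: C)%VS.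
  by case/memv_imgP => c cC ->; rewrite -uh memv_img ?submodP.
exists (submod_of Cs_st).
  by apply: iso_trans CM; apply: iso_sym; apply: (quotient_image uh uinj).
have uD : (u @: D)%VS = (D : {vspace P}).
  apply/eqP; rewrite eqEdim u0 leqnn andbT.
  apply/subvP => _ /memv_imgP[x xD ->].
  by rewrite uE memvD ?memvZ ?(core_stable DE).
have Dsub : (D <= u @: C)%VS by rewrite -uD limgS // (core_sub DE).
have TL0 x : x \in (L : {vspace P}) -> x + s *: eta0 x \in (u @: C)%VS.
  case/memv_addP=> _ /memv_imgP[c cC ->] [d dD ->].
  rewrite linearD /= (eta0_D d dD) addr0; set c1 := eta0 (v c).
  have -> : v c + d + s *: c1 = u c1 + (d - v (c1 - c)).
    by rewrite uE linearB /= opprB [d + (_ - _)]addrA [RHS]addrC addrA subrK [d + _]addrC.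
  by rewrite memvD ?memv_img ?eta0_C // (subvP Dsub) // memvB // eta0_v.
have TE x : (\1 + s *: eta)%VF x = x + s *: eta x.
  by rewrite add_lfunE scale_lfunE id_lfunE.
apply/eqP; rewrite eqEdim; apply/andP; split.
  apply/subvP => _ /memv_imgP[x xL ->]; rewrite TE etaE.
  rewrite -{1}[x]act1x -e_sum act_suml scaler_sumr -big_split.
  apply: memv_suml => i _ /=; rewrite -{1}(ee i) actMx -linearZ -linearD /=.
  by apply: Cs_st; apply: TL0; apply: submodP.
rewrite /= u0 limg_dim_eq ?(dim_limit vh DE) //.
apply/eqP; rewrite -subv0; apply/subvP => x.
by rewrite memv_cap memv_ker memv0 TE => /andP[_ /eqP/Tinj ->].
Qed.

End MoveDegeneration.

(** * Free modules *)

Section FreeModule.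
Variables (K : fieldType) (A : falgType K) (S : finType).

Definition free_map (a : A) (x : {ffun S -> A}) : {ffun S -> A} :=
  [ffun s => a * x s].

Fact free_map_linear a : linear (free_map a).
Proof. by move=> k x y; apply/ffunP=> s; rewrite !ffunE mulrDr scalerAr. Qed.
HB.instance Definition _ a := GRing.isLinear.Build K _ _ _
  (free_map a) (free_map_linear a).

Definition free_act (a : A) : 'End({ffun S -> A}) := linfun (free_map a).

Fact free_act_linear : linear free_act.
Proof.
move=> k a b; apply/lfunP=> x; rewrite add_lfunE scale_lfunE !lfunE /=.
by apply/ffunP=> s; rewrite !ffunE mulrDl scalerAl.
Qed.
HB.instance Definition _ := GRing.isLinear.Build K A 'End({ffun S -> A}) _
  free_act free_act_linear.

Fact free_act1 : free_act 1 = \1%VF.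
Proof. by apply/lfunP=> x; apply/ffunP=> s; rewrite lfunE /= ffunE mul1r id_lfunE. Qed.

Fact free_actM a b : free_act (a * b) = (free_act a \o free_act b)%VF.
Proof.
by apply/lfunP=> x; apply/ffunP=> s; rewrite comp_lfunE !lfunE /= !ffunE mulrA.
Qed.

(** The free module with basis S. *)
Definition free_mod : fdmod A := FdMod free_act1 free_actM.

Lemma free_actE a (x : free_mod) s : act free_mod a x s = a * (x s).
Proof. by rewrite lfunE /= ffunE. Qed.

Lemma free_addE (x y : free_mod) s : (x + y) s = x s + y s.
Proof. by rewrite ffunE. Qed.

Lemma free_scaleE k (x : free_mod) s : (k *: x) s = k *: x s.
Proof. by rewrite ffunE. Qed.

Lemma free_zeroE s : (0 : free_mod) s = 0.
Proof. by rewrite ffunE. Qed.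

Lemma free_sumE (I : Type) (r : seq I) (F : I -> free_mod) s :
  (\sum_(i <- r) F i) s = \sum_(i <- r) F i s.
Proof.
by rewrite (big_morph (fun x : free_mod => x s) (fun x y => free_addE x y s) (free_zeroE s)).
Qed.

(** The vector with entry a at s. *)
Definition single (s : S) (a : A) : free_mod :=
  [ffun s' => if s' == s then a else 0].

Lemma singleE s a s' : single s a s' = if s' == s then a else 0.
Proof. by rewrite ffunE. Qed.

Lemma act_single a s b : act free_mod a (single s b) = single s (a * b).
Proof.
by apply/ffunP=> s'; rewrite free_actE !singleE; case: eqP; rewrite ?mulr0.
Qed.

Lemma free_decomp (x : free_mod) : x = \sum_s single s (x s).
Proof.
apply/ffunP=> s; rewrite free_sumE (bigD1 s) //= singleE eqxx big1 ?addr0 //.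
by move=> s' ss'; rewrite singleE eq_sym (negPf ss').
Qed.

Lemma free_gen (x : free_mod) : x = \sum_s act free_mod (x s) (single s 1).
Proof.
by rewrite {1}[x]free_decomp; apply: eq_bigr => s _; rewrite act_single mulr1.
Qed.

Definition elem_fun (k l : S) (w : A) (x : free_mod) : free_mod :=
  single l (x k * w).

Fact elem_linear k l w : linear (elem_fun k l w).
Proof.
move=> c x y; apply/ffunP=> s; rewrite free_addE free_scaleE !singleE.
rewrite free_addE free_scaleE.
by case: eqP => _; rewrite ?scaler0 ?addr0 // mulrDl scalerAl.
Qed.
HB.instance Definition _ k l w := GRing.isLinear.Build K _ _ _
  (elem_fun k l w) (elem_linear k l w).

(** The endomorphism sending the k-th basis vector to w times the l-th one and
    the other basis vectors to 0. *)
Definition elem k l w : 'End(free_mod) := linfun (elem_fun k l w).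

Lemma elemE k l w x : elem k l w x = single l (x k * w).
Proof. by rewrite lfunE. Qed.

Lemma elem_hom k l w : is_hom (elem k l w).
Proof. by move=> a x; rewrite !elemE free_actE act_single mulrA. Qed.

End FreeModule.

(** * Modules without proper top-stable degenerations *)

Section Existence.
Variables (K : closedFieldType) (A : falgType K) (n : nat) (e : 'I_n -> A).
Hypothesis ee : forall i, idempotent_elt (e i).
Hypothesis e_ortho : forall i j, i != j -> e i * e j = 0.
Hypothesis e_sum : \sum_i e i = 1.
Variables (M : fdmod A) (t : 'I_n -> nat).
Local Notation slot := (slot t).
Hypothesis hT : iso (top M) (cyclic_sum e (fun i (_ : 'I_(t i)) => Je (e i))).
Hypothesis rigid : forall M', degeneration e M M' -> iso (top M') (top M) ->
  iso M' M.

Local Notation J := (jacobson A).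
Let S : finType := {i : 'I_n & 'I_(t i)}.
Let P := free_mod A S.

(** The module A e_i is the quotient of A by A (1 - e_i). So C is admissible if it
    is the preimage in the free module of a submodule of the radical of the
    direct sum of the A e_i, one for each slot, with quotient M. *)
Definition admissible (C : submod P) :=
  [/\ iso (quotient C) M,
      forall x : P, (forall s, x s * e (tag s) = 0) -> x \in (C : {vspace P}) &
      forall x : P, x \in (C : {vspace P}) -> forall s, x s * e (tag s) \in J].

Lemma admissible_ex : exists C, admissible C.
Proof.
have [zb [ezb zbgen zbJ]] := (presents_iso ee _ _).2 hT.
have /choice[y yE] : forall s : S, exists y : M, zb s = quot_proj (rad M) y.
  by move=> s; apply: quot_surj.
pose z (s : S) := act M (e (tag s)) (y s).
have qz s : quot_proj (rad M) (z s) = zb s by rewrite quot_hom -yE ezb.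
pose phi_fun (x : P) : M := \sum_(s : S) act M (x s) (z s).
have phi_lin : linear phi_fun.
  move=> k u v; rewrite /phi_fun scaler_sumr -big_split; apply: eq_bigr => s _ /=.
  by rewrite free_addE free_scaleE actDl actZl.
pose phiL := GRing.isLinear.Build K P M _ phi_fun phi_lin.
pose phi_l : {linear P -> M} := HB.pack phi_fun phiL.
pose phi : 'Hom(P, M) := linfun phi_l.
have phiE x : phi x = \sum_(s : S) act M (x s) (z s) by rewrite lfunE.
have phih : is_hom phi.
  move=> a x; rewrite !phiE linear_sum; apply: eq_bigr => s _ /=.
  by rewrite free_actE actMx.
have phi_st a x : x \in limg phi -> act M a x \in limg phi.
  by case/memv_imgP => u _ ->; rewrite -phih memv_img ?memvf.
have phi_surj x : exists u, x = phi u.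
  have full : (submod_of phi_st : {vspace M}) = fullv.
    apply: nakayama; apply/vspaceP => w; rewrite memvf.
    have [a aE] := zbgen (quot_proj (rad M) w).
    rewrite -[w](subrK (phi [ffun s => a s])) addrC memv_add ?memv_img ?memvf //.
    rewrite -quot_proj_eq0 linearB /= aE phiE linear_sum subr_eq0; apply/eqP.
    by apply: eq_bigr => s _; rewrite ffunE -qz -quot_hom.
  have : x \in limg phi by have := memvf x; rewrite -full.
  by case/memv_imgP => u _ ->; exists u.
have ker_st (a : A) (x : P) : x \in lker phi -> act P a x \in lker phi.
  by rewrite !memv_ker phih => /eqP ->; rewrite linear0.
exists (submod_of ker_st); split.
- by apply: (first_iso phih phi_surj) => x; rewrite /= memv_ker.
- move=> x xe; rewrite /= memv_ker phiE big1 // => s _.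
  by rewrite /z -actMx xe act0l.
move=> x; rewrite /= memv_ker phiE => /eqP x0.
have /zbJ h : \sum_(s : S) act (top M) (x s) (zb s) = 0.
  rewrite -[RHS](linear0 (quot_proj (rad M))) -x0 linear_sum.
  by apply: eq_bigr => s _; rewrite -qz -quot_hom.
by move=> s; have /mem_Je-/(_ (ee _)) [] := h s.
Qed.

Section Presentation.
Variables (C : submod P).
Hypothesis C_nil : forall x : P, (forall s, x s * e (tag s) = 0) ->
  x \in (C : {vspace P}).

(** The image in P / C of a basis vector of P. *)
Definition free_class s : quotient C := quot_proj C (single s 1).

Lemma free_class_sum (a : S -> A) :
  \sum_s act (quotient C) (a s) (free_class s) = quot_proj C [ffun s => a s].
Proof.
rewrite [X in _ = quot_proj C X]free_gen linear_sum.
by apply: eq_bigr => s _; rewrite ffunE -quot_hom.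
Qed.

Lemma free_class_e s : act (quotient C) (e (tag s)) (free_class s) = free_class s.
Proof.
rewrite /free_class -quot_hom act_single mulr1; apply/eqP.
rewrite -subr_eq0 -(linearB (quot_proj C)) quot_proj_eq0; apply: C_nil => s'.
rewrite !ffunE; case: eqP => [->|_]; last by rewrite subr0 mul0r.
by rewrite mulrBl ee mul1r subrr.
Qed.

Lemma free_class_gen x : exists a : S -> A,
  x = \sum_s act (quotient C) (a s) (free_class s).
Proof.
have [y ->] := quot_surj x; exists y; rewrite free_class_sum; congr (quot_proj C _).
by apply/ffunP=> s; rewrite ffunE.
Qed.

End Presentation.

(** The top of P / C is that of M as soon as C satisfies the last two conditions
    of admissibility. *)
Lemma top_quotient (C : submod P) :
  (forall x : P, (forall s, x s * e (tag s) = 0) -> x \in (C : {vspace P})) ->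
  (forall x : P, x \in (C : {vspace P}) -> forall s, x s * e (tag s) \in J) ->
  iso (top (quotient C)) (top M).
Proof.
move=> Cn Cr; apply: iso_trans (iso_sym hT); apply/(presents_iso ee).
pose q := quot_proj (rad (quotient C)).
have qsum a : q (\sum_s act _ (a s) (free_class C s)) =
    \sum_s act (top (quotient C)) (a s) (q (free_class C s)).
  rewrite (linear_sum q); apply: eq_bigr => s _; rewrite [LHS]quot_hom.
  by [].
exists (fun s => q (free_class C s)); split=> [s|x|a].
- by rewrite -quot_hom free_class_e.
- have [y ->] := quot_surj x; have [a ->] := free_class_gen y.
  by exists a; rewrite -qsum.
rewrite -qsum; split=> [/eqP|aJ].
  rewrite quot_proj_eq0 => /(rad_gen (@free_class_gen C))[b bJ].
  move/eqP; rewrite !free_class_sum -subr_eq0 -(linearB (quot_proj C)) quot_proj_eq0 => /Cr h s.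
  apply/mem_Je => //; split; last by rewrite -mulrA ee.
  have := h s; rewrite !ffunE mulrBl => hs.
  by rewrite -[_ * _](subrK (b s * e (tag s))) memvD ?jacobsonMr.
apply/eqP; rewrite quot_proj_eq0; apply: memv_suml => s _.
rewrite -(free_class_e Cn) -actMx; apply: memv_rad.
by have /mem_Je-/(_ (ee _)) [] := aJ s.
Qed.

(** Passing to the limit of C under v + s, for elementary v, preserves
    admissibility, by rigidity of M. *)
Lemma admissible_limit (C D : submod P) k l w (v : 'End(P) := elem k l w)
    (vh : is_hom v := elem_hom k l w) : admissible C ->
  (forall x, x \in (D : {vspace P}) <-> forall j, iter j v x \in (C : {vspace P})) ->
  e (tag k) * w = w * e (tag l) -> admissible (limit vh C D).
Proof.
move=> aC DE ew; have [CM Cn Cr] := aC.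
have nil_v (x : P) : (forall s, x s * e (tag s) = 0) ->
    forall s, v x s * e (tag s) = 0.
  move=> xn s; rewrite elemE singleE; case: eqP => [->|_]; last by rewrite mul0r.
  by rewrite -mulrA -ew mulrA xn mul0r.
have Ln (x : P) : (forall s, x s * e (tag s) = 0) ->
    x \in (limit vh C D : {vspace P}).
  move=> xn; apply: (subvP (core_sub_limit vh C D)); apply/DE => j; apply: Cn.
  by elim: j => [//|j IH] /=; apply: nil_v.
have Lr (x : P) : x \in (limit vh C D : {vspace P}) ->
    forall s, x s * e (tag s) \in J.
  case/memv_addP=> _ /memv_imgP[c cC ->] [d dD ->] s.
  rewrite free_addE mulrDl memvD //; last by apply: Cr; apply: (subvP (core_sub DE)).
  rewrite elemE singleE; case: eqP => [->|_]; last by rewrite mul0r mem0v.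
  by rewrite -mulrA -ew mulrA jacobsonMr // Cr.
split=> //; apply: rigid; last exact: top_quotient.
exact: (limit_degeneration ee e_ortho e_sum vh DE CM).
Qed.

Let r := (\sum_i t i).+1.
Let pos (s : S) : nat := tagged s.

Let pos_lt s : (pos s < r)%N.
Proof.
rewrite ltnS; apply: leq_trans (ltnW (ltn_ord (tagged s))) _.
by rewrite (bigD1 (tag s)) //= leq_addr.
Qed.

(** The least h such that h r + pos s is at least m. *)
Let level m s := ((m - pos s + r.-1) %/ r)%N.

Let in_flag m (x : P) := forall s, x s \in jpow A (level m s).

(** A refinement of the radical filtration of P: an entry at s in the h-th power
    of J has weight h r + pos s, and F m consists of the vectors all of whose
    entries have weight at least m. *)
Lemma flag_ex : exists F : nat -> {vspace P}, forall m x, x \in F m <-> in_flag m x.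
Proof.
suff /choice[F FE] : forall m, exists U : {vspace P},
    forall x, x \in U <-> in_flag m x by exists F.
move=> m; apply: vspace_of_pred => [s|k x y xF yF s].
  by rewrite free_zeroE mem0v.
by rewrite free_addE free_scaleE memvD ?memvZ.
Qed.

Lemma single_flag m l (y : A) :
  y \in jpow A (level m l) -> in_flag m (single l y).
Proof. by move=> yl s; rewrite singleE; case: eqP => [->|_]; rewrite ?mem0v. Qed.

(** The elementary endomorphisms that raise the filtration: w is radical, or the
    target has a higher position than the source. *)
Definition raising (k l : S) (w : A) :=
  w \in J \/ (pos k < pos l)%N.

Lemma raising_flag m k l w x : raising k l w -> in_flag m x ->
  in_flag m.+1 (elem k l w x).
Proof.
move=> kl xm; rewrite elemE; apply: single_flag; have := xm k.
have pl := pos_lt l; have pk := pos_lt k; case: kl => [wJ xk|kl xk].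
  apply: (subvP (jpow_mono _ _)) (jpow_mulr xk wJ).
  rewrite /level; set h := r.-1; have hr : r = h.+1 by [].
  have -> : forall y, (y %/ r).+1 = ((y + r) %/ r)%N.
    by move=> y; rewrite divnDr // divnn addn1.
  by apply: leq_div2r; lia.
apply: (subvP (jpow_mono _ _)) (jpow_mulfr w xk).
by rewrite /level; apply: leq_div2r; lia.
Qed.

Lemma diag_flag m s x : in_flag m x -> in_flag m (elem s s 1 x).
Proof. by move=> xm; rewrite elemE mulr1; apply: single_flag. Qed.

Lemma flag0 x : in_flag 0 x.
Proof. by move=> s; rewrite /level sub0n add0n divn_small ?jpow0 ?memvf. Qed.

Lemma flag_end : exists L, forall x, in_flag L x -> x = 0.
Proof.
have [H H0] := jpow_nilp A; exists (r * H + r)%N => x xL.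
apply/ffunP => s; rewrite free_zeroE; apply/eqP.
rewrite -memv0 -H0; apply: (subvP (jpow_mono A _)) (xL s).
have ps := pos_lt s; rewrite /level -{1}(mulKn H (ltn0Sn _ : 0 < r)%N).
by apply: leq_div2r; lia.
Qed.

Let is_core v (C D : submod P) := forall x : P, x \in (D : {vspace P}) <->
  forall j, iter j v x \in (C : {vspace P}).

(** The potential of C is the sum of the dimensions of its intersections with the
    members of the filtration. *)
Lemma potential_ex : exists (Psi : submod P -> nat) (b : nat),
  [/\ forall C, (Psi C <= b)%N,
      forall (C D : submod P) k l w, is_core (elem k l w) C D -> raising k l w ->
        (Psi C + \dim C <= Psi (limit (elem_hom k l w) C D) + \dim D)%N &
      forall (C D : submod P) s, is_core (elem s s 1) C D ->
        (Psi C <= Psi (limit (elem_hom s s 1%R) C D))%N].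
Proof.
have [F FE] := flag_ex; have [L FL] := flag_end.
have F0 : F 0%N = fullv by apply/vspaceP => x; rewrite memvf; apply/FE/flag0.
have FL0 : F L = 0%VS.
  by apply/eqP; rewrite -subv0; apply/subvP => x /FE/FL ->; rewrite mem0v.
pose Psi (C : submod P) := (\sum_(m < L) \dim (C :&: F m))%N.
exists Psi, (\sum_(m < L) \dim {:P})%N; split.
- by move=> C; apply: leq_sum => m _; rewrite dimvS ?subvf.
- move=> C D k l w DE kl; set C' := limit _ _ _.
  have shift (U : submod P) :
      (\sum_(m < L) \dim (U :&: F m.+1) + \dim U = Psi U)%N.
    have E : (\sum_(m < L.+1) \dim (U :&: F m) =
        \dim (U :&: F 0) + \sum_(m < L) \dim (U :&: F m.+1))%N.
      by rewrite big_ord_recl.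
    move: E; rewrite big_ord_recr /= F0 FL0 capvf capv0 dimv0 addn0.
    by rewrite addnC => <-.
  have step : (Psi C + \sum_(m < L) \dim (D :&: F m.+1) <=
      \sum_(m < L) \dim (C' :&: F m.+1) + Psi D)%N.
    rewrite -!big_split; apply: leq_sum => m _ /=.
    apply: (dim_limit_geq (elem_hom k l w) DE).
    by apply/subvP => _ /memv_imgP[x /FE xm ->]; apply/FE; apply: raising_flag.
  have := shift C'; have := shift D; have := dim_limit (elem_hom k l w) DE.
  rewrite -/C' => dC ED EC; move: step; rewrite -ED -EC dC.
  by rewrite addnCA addnC leq_add2l addnAC leq_add2r.
move=> C D s DE; apply: leq_sum => m _.
have := dim_limit_geq (elem_hom s s 1) DE (F := F m) (G := F m).
rewrite leq_add2r; apply.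
by apply/subvP => _ /memv_imgP[x /FE xm ->]; apply/FE; apply: diag_flag.
Qed.

(** M is the quotient of P by a submodule that is homogeneous and stable under
    all raising homomorphisms: among the admissible submodules, those of largest
    potential are stable under raising homomorphisms, and homogeneity is reached
    by limits that do not decrease the potential. *)
Lemma stable_admissible : exists C, [/\ admissible C,
  forall s (x : P), x \in (C : {vspace P}) -> elem s s 1 x \in (C : {vspace P}) &
  forall k l w (x : P), raising k l w -> e (tag k) * w = w * e (tag l) ->
    x \in (C : {vspace P}) -> elem k l w x \in (C : {vspace P})].
Proof.
have [Psi [b [Psib raise diag]]] := potential_ex.
pose Q k := `[< exists C, admissible C /\ Psi C = k >].
have exQ : exists k, Q k.
  by have [C aC] := admissible_ex; exists (Psi C); apply/asboolP; exists C.
have bQ k : Q k -> (k <= b)%N by case/asboolP => C [_ <-].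
case: (ex_maxnP exQ bQ) => k /asboolP[C0 [aC0 C0k]] maxk.
have {}maxk C : admissible C -> (Psi C <= k)%N.
  by move=> aC; apply: maxk; apply/asboolP; exists C.
(* Homogeneity is achieved for one slot after the other, keeping the potential
   maximal. *)
have [C [aC Ck Chom]] : exists C, [/\ admissible C, Psi C = k &
    forall s, s \in enum S -> forall x : P,
      x \in (C : {vspace P}) -> elem s s 1 x \in (C : {vspace P})].
  elim: (enum S) => [|s ss [C [aC Ck Css]]]; first by exists C0; split.
  have [D DE] := stable_core (elem_hom s s 1) C.
  have aC' := admissible_limit aC DE (etrans (mulr1 _) (esym (mul1r _))).
  exists (limit (elem_hom s s 1) C D); split=> //.
    by apply/eqP; rewrite eqn_leq maxk //= -Ck diag.
  have comm s' (x : P) : elem s' s' 1 (elem s s 1 x) = elem s s 1 (elem s' s' 1 x).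
    apply/ffunP => s1; rewrite !elemE !singleE !mulr1.
    by case: (eqVneq s s') => [->//|ss']; rewrite if_same if_same.
  move=> s' s'ss _ /memv_addP[_ /memv_imgP[c cC ->] [d dD ->]].
  rewrite linearD; apply: memv_add; rewrite /=.
    rewrite comm; case/predU1P: s'ss => [->|s'ss].
      have -> : elem s s 1 (elem s s 1 c) = elem s s 1 c.
        by rewrite !elemE singleE eqxx !mulr1.
      exact: memv_img.
    by apply: memv_img; apply: Css.
  case/predU1P: s'ss => [->|s'ss]; first exact: (core_stable DE).
  apply/DE => j; have -> : iter j (elem s s 1) (elem s' s' 1 d) =
      elem s' s' 1 (iter j (elem s s 1) d).
    by elim: j => //= j ->; rewrite comm.
  by apply: Css => //; apply: (DE d).1.
exists C; split=> // [s x xC|k' l w x kl ew xC]; first by rewrite Chom ?mem_enum.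
have [D DE] := stable_core (elem_hom k' l w) C.
have aC' := admissible_limit aC DE ew.
have := raise _ _ _ _ _ DE kl; have := maxk _ aC'; rewrite Ck => le1 le2.
(* By maximality of the potential, the stable core of C is C itself. *)
have /eqP DC : (D : {vspace P}) == C.
  rewrite eqEdim (core_sub DE) /=.
  by rewrite -(leq_add2l k); apply: leq_trans le2 _; rewrite leq_add2r.
by rewrite -DC (core_stable DE) // DC.
Qed.

(** The decomposition of M given by a homogeneous submodule stable under the
    raising homomorphisms. *)
Lemma rigid_presentation : exists C : forall i : 'I_n, 'I_(t i) -> left_ideal A,
  [/\ iso M (cyclic_sum e C),
      (forall (i : 'I_n) (j : 'I_(t i)), (C i j <= Ae (e i))%VS),
      (forall (i : 'I_n) (j j' : 'I_(t i)),
        (C i j <= C i j')%VS \/ (C i j' <= C i j)%VS) &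
      (forall (i k : 'I_n)
          (f : 'Hom(submodule (Ae (e i)), submodule (Je (e k)))),
          is_hom f ->
        forall (j : 'I_(t i)) (l : 'I_(t k)) (x : submodule (Ae (e i))),
          vsval x \in sub_space (C i j) -> vsval (f x) \in sub_space (C k l))].
Proof.
have [C [[CM Cn _] Chom Craise]] := stable_admissible.
have single_lin s k (a b : A) :
    single s (k *: a + b) = k *: (single s a : P) + (single s b : P).
  apply/ffunP => s'; rewrite free_addE free_scaleE !singleE.
  by case: eqP; rewrite ?scaler0 ?addr0.
have /choice[Cs CsE] : forall s : S, exists I : left_ideal A, forall a,
    a \in (I : {vspace A}) <->
    a * e (tag s) = a /\ (single s a : P) \in (C : {vspace P}).
  move=> s; have [||U UE] := @vspace_of_pred _ A
      (fun a => a * e (tag s) = a /\ (single s a : P) \in (C : {vspace P})).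
  - split; first by rewrite mul0r.
    by apply: Cn => s'; rewrite singleE; case: eqP; rewrite mul0r.
  - move=> k a b [ae aC] [be bC]; split; first by rewrite mulrDl -scalerAl ae be.
    by rewrite single_lin memvD ?memvZ.
  have Ust (a x : A) : x \in (U : {vspace regular A}) ->
      act (regular A) a x \in (U : {vspace regular A}).
    move/UE => [xe xC]; apply/UE; rewrite regularE -mulrA xe; split=> //.
    by rewrite -act_single submodP.
  by exists (@submod_of _ _ (regular A) U Ust).
pose slot_of i (j : 'I_(t i)) : S := Tagged (fun i => 'I_(t i)) j.
exists (fun i j => Cs (slot_of i j)); split.
- apply: iso_trans (iso_sym CM) _; apply/(presents_iso ee); exists (free_class C).
  split; [exact: free_class_e | exact: free_class_gen |] => a; rewrite free_class_sum.
  have sCs s : a s * e (tag s) \in (Cs (slot_of _ (tagged s)) : {vspace A}) <->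
      (single s (a s) : P) \in (C : {vspace P}).
    rewrite /slot_of; case: s => i j /=; set s := Tagged _ _.
    have dC : (single s (a s - a s * e (tag s)) : P) \in (C : {vspace P}).
      apply: Cn => s'; rewrite singleE; case: eqP => [->|_]; last by rewrite mul0r.
      by rewrite mulrBl -mulrA ee subrr.
    have sE : single s (a s) = (single s (a s * e (tag s)) : P) +
        (single s (a s - a s * e (tag s)) : P).
      by rewrite -[single s (_ * _)]scale1r -single_lin scale1r addrC subrK.
    rewrite CsE -mulrA ee sE; split=> [[_ h]|h]; first by rewrite memvD.
    by split=> //; rewrite -[single s (_ * _)](addrK (single s (a s - a s * e (tag s)))) memvB.
  split=> [/eqP|h].
    rewrite quot_proj_eq0 => aC s; apply/sCs.
    by have := Chom s _ aC; rewrite elemE mulr1 ffunE.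
  apply/eqP; rewrite quot_proj_eq0 [X in X \in _]free_decomp memv_suml // => s _.
  by rewrite ffunE; apply/sCs.
- by move=> i j; apply/subvP => a /CsE[ae _]; apply/mem_Ae.
- have le i (j j' : 'I_(t i)) : (j < j')%N ->
      (Cs (slot_of i j) <= Cs (slot_of i j'))%VS.
    move=> jj'; apply/subvP => a /CsE[ae aC]; apply/CsE; split=> //.
    have := @Craise (slot_of i j) (slot_of i j') (e i) _ (or_intror jj') erefl aC.
    by rewrite elemE singleE eqxx ae.
  move=> i j j'; case: (ltngtP j j') => [/le|/le|/val_inj ->]; [by left|by right|left].
  exact: subvv.
move=> i k f fh j l x /CsE[xe xC].
pose eps := vsproj (Ae (e i)) (e i); pose u := vsval (f eps).
have epsE : vsval eps = e i by rewrite vsprojK //; apply/mem_Ae; apply: ee.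
have fE y : vsval (f y) = vsval y * u.
  have yE : y = act (submodule (Ae (e i))) (vsval y) eps.
    apply: subvs_inj; rewrite sub_actE regularE epsE; apply/esym/mem_Ae => //.
    exact: subvsP.
  by rewrite {1}yE fh sub_actE regularE.
have /mem_Je-/(_ (ee k)) [uJ ue] : u \in (Je (e k) : {vspace A}) by apply: subvsP.
have eu : e i * u = u by rewrite -epsE -fE.
rewrite fE; apply/CsE; split; first by rewrite -mulrA ue.
have := @Craise (slot_of i j) (slot_of k l) u _ (or_introl uJ) (etrans eu (esym ue)) xC.
by rewrite elemE singleE eqxx.
Qed.

End Existence.

Theorem theoremA (K : closedFieldType) (A : falgType K) (n : nat)
    (e : 'I_n -> A) (he : full_primitive_idempotents e) (hA : basic e)
    (M : fdmod A) (t : 'I_n -> nat)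
    (hT : iso (top M) (dsum (fun i : 'I_n =>
            dsum (fun j : 'I_(t i) => simple_mod (e i))))) :
  (~ exists M' : fdmod A, proper_top_stable_degeneration e M M')
  <->
  (exists C : forall i : 'I_n, 'I_(t i) -> left_ideal A,
    [/\ iso M (dsum (fun i : 'I_n =>
            dsum (fun j : 'I_(t i) => subquotient (Ae (e i)) (C i j)))),
        (forall (i : 'I_n) (j : 'I_(t i)), (C i j <= Ae (e i))%VS),
        (forall (i : 'I_n) (j j' : 'I_(t i)),
            (C i j <= C i j')%VS \/ (C i j' <= C i j)%VS) &
        (forall (i k : 'I_n)
            (f : 'Hom(submodule (Ae (e i)), submodule (Je (e k)))),
            is_hom f ->
          forall (j : 'I_(t i)) (l : 'I_(t k)) (x : submodule (Ae (e i))),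
            vsval x \in sub_space (C i j) -> vsval (f x) \in sub_space (C k l))]).
Proof.
have [ep e_ortho e_sum] := he.
have ee i : idempotent_elt (e i) by case: (ep i).
split=> [no|[C [MC CA Cch Chom]] [M' [deg nM' tM']]]; last first.
  by apply: nM'; apply: (rigid_iso he hA hT MC CA Cch Chom deg tM').
apply: (rigid_presentation ee e_ortho e_sum hT) => M' deg tM'.
by apply: contrapT => nM'; apply: no; exists M'.
Qed.
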